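(* Let $n\ge 4$. Then the reduced homology group $\tilde{H}_i(\mathcal{N}(\mathbb{I}_n,3);\mathbb{Z})$ is nonzero if and only if $i\in\{3,4\}$.
   Context: For a finite simple connected graph $G$ and a real number $r\ge 0$, the Čech complex $\mathcal{N}(G,r)$ is the simplicial complex with vertex set $V(G)$ in which a finite nonempty set $\sigma\subseteq V(G)$ is a simplex if and only if the closed balls of radius $\frac r2$ centered at the vertices of $\sigma$ have a common point, the balls being taken in the geometric realization of $G$ with the shortest path metric in which each edge is isometric to $[0,1]$. The hypercube graph $\mathbb{I}_n$ has vertex set $\{0,1\}^n$, two vertices adjacent iff they differ in exactly one coordinate. *)

(* Defs.v *)
From HB Require Import structures.
From mathcomp Require Import boolp classical_sets reals.
From mathcomp Require Import all_boot all_order all_algebra.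
From mathcomp Require Import ring_quotient.

Set Implicit Arguments.
Unset Strict Implicit.
Unset Printing Implicit Defensive.

Import Order.TTheory GRing.Theory Num.Theory.
Local Open Scope ring_scope.

Record conn_graph := ConnGraph {
  vertex :> finType;
  adj : rel vertex;
  adj_sym : symmetric adj;
  adj_irr : irreflexive adj;
  adj_conn : forall u v, connect adj u v }.

Section GeometricRealization.
Variables (R : realType) (G : conn_graph).

(* Points of the geometric realization are given by their barycentric
   coordinates: a function G -> R supported on a vertex or on an edge.
   [edge_point u v t] is the point at distance t from u on the edge uv. *)
Definition vertex_point (v : G) : {ffun G -> R} := [ffun w => (w == v)%:R].

Definition edge_point (u v : G) (t : R) : {ffun G -> R} :=
  [ffun w => (1 - t) * (w == u)%:R + t * (w == v)%:R].

Definition realization : set {ffun G -> R} :=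
  [set x | (exists v, x = vertex_point v) \/
           (exists u v t, [/\ adj u v, 0 <= t <= 1 & x = edge_point u v t])]%classic.

(* [route x y l]: a path of length l from x to y, made of finitely many
   segments, each inside one closed edge parametrized by [0, 1]. *)
Inductive route : {ffun G -> R} -> {ffun G -> R} -> R -> Prop :=
| route_nil x : route x x 0
| route_cons u v s t y l : adj u v -> 0 <= s <= 1 -> 0 <= t <= 1 ->
    route (edge_point u v t) y l ->
    route (edge_point u v s) y (`|s - t| + l).

Definition path_dist (x y : {ffun G -> R}) : R :=
  inf [set l | route x y l]%classic.

Definition closed_ball_at (x : {ffun G -> R}) (r : R) : set {ffun G -> R} :=
  [set y | realization y /\ path_dist x y <= r]%classic.

End GeometricRealization.

Record simplicial_complex (V : finType) := SimplicialComplex {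
  simplices : {set {set V}};
  simplices_neq0 : set0 \notin simplices;
  simplices_sub : forall s t : {set V},
    s \in simplices -> t \subset s -> t != set0 -> t \in simplices }.

Section Cech.
Variables (R : realType) (G : conn_graph) (r : R).

Definition cech_simplices : {set {set G}} :=
  [set s : {set G} | (s != set0) &&
    `[< exists p, forall v, v \in s ->
          closed_ball_at (vertex_point R v) (r / 2) p >]].

Fact cech_simplices_neq0 : set0 \notin cech_simplices.
Proof. by rewrite inE eqxx. Qed.

Fact cech_simplices_sub (s t : {set G}) :
  s \in cech_simplices -> t \subset s -> t != set0 -> t \in cech_simplices.
Proof.
rewrite !inE => /andP[_ /asboolP[p Hp]] /subsetP ts -> /=.
by apply/asboolP; exists p => v /ts; exact: Hp.
Qed.

Definition cech : simplicial_complex G :=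
  SimplicialComplex cech_simplices_neq0 cech_simplices_sub.

End Cech.

Section ReducedHomology.
Variables (V : finType) (K : simplicial_complex V).

Definition chain := {ffun {set V} -> int}.

(* The empty set spans the chain group in degree -1 (augmentation). *)
Definition is_simplex_of_dim (i : int) (s : {set V}) : bool :=
  ((s == set0) || (s \in simplices K)) && (#|s|%:Z == i + 1).

Definition chains (i : int) : {pred chain} :=
  [pred c : chain | [forall s, (c s != 0) ==> is_simplex_of_dim i s]].

(* Simplices are oriented by the enumeration order of V: the sign of the facet
   [s :\ v] in the boundary of s is (-1)^k, with k the position of v in s. *)
Definition vertex_position (s : {set V}) (v : V) : nat :=
  #|[set w in s | (enum_rank w < enum_rank v)%N]|.

Definition bdry (c : chain) : chain :=
  [ffun t : {set V} =>
    \sum_(s : {set V}) \sum_(v in s | s :\ v == t)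
      (-1) ^+ vertex_position s v * c s].

Fact bdry_is_zmod_morphism : zmod_morphism bdry.
Proof.
move=> c d; apply/ffunP => t; rewrite !ffunE -sumrB.
apply: eq_bigr => s _; rewrite -sumrB; apply: eq_bigr => v _.
by rewrite !ffunE mulrBr.
Qed.
HB.instance Definition _ :=
  GRing.isZmodMorphism.Build chain chain bdry bdry_is_zmod_morphism.

Fact chains_zmod_closed i : zmod_closed (chains i).
Proof.
split=> [|c d]; rewrite ?inE.
  by apply/forallP => s; rewrite ffunE eqxx.
move=> /forallP cP /forallP dP; apply/forallP => s; apply/implyP.
move: (cP s) (dP s); rewrite !ffunE.
by case: (eqVneq (c s) 0) => [->|//]; case: (eqVneq (d s) 0) => [->|//]; rewrite subrr.
Qed.
HB.instance Definition _ i :=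
  GRing.isZmodClosed.Build chain (chains i) (chains_zmod_closed i).

Definition cycles (i : int) : {pred chain} :=
  [pred c : chain | (c \in chains i) && (bdry c == 0)].

Fact cycles_zmod_closed i : zmod_closed (cycles i).
Proof.
split=> [|c d]; first by apply/andP; rewrite raddf0 eqxx; split=> //; exact: rpred0.
move=> /andP[cC /eqP c0] /andP[dC /eqP d0]; apply/andP; split; first exact: rpredB.
by rewrite raddfB /= c0 d0 subrr.
Qed.
HB.instance Definition _ i :=
  GRing.isZmodClosed.Build chain (cycles i) (cycles_zmod_closed i).

Record cycle (i : int) := Cycle { cycle_val :> chain; _ : cycle_val \in cycles i }.
HB.instance Definition _ i := [isSub for @cycle_val i].
HB.instance Definition _ i := [Choice of cycle i by <:].
HB.instance Definition _ i := [SubChoice_isSubZmodule of cycle i by <:].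

Definition boundaries (i : int) : {pred cycle i} :=
  [pred z : cycle i | `[< exists2 b, b \in chains (i + 1) & bdry b = z >]].

Fact boundaries_zmod_closed i : zmod_closed (@boundaries i).
Proof.
split=> [|x y]; rewrite !inE.
  by apply/asboolP; exists 0; rewrite ?rpred0 ?raddf0.
move=> /asboolP[b bC bx] /asboolP[d dC dy]; apply/asboolP.
by exists (b - d); rewrite ?rpredB // raddfB /= bx dy.
Qed.
HB.instance Definition _ i :=
  GRing.isZmodClosed.Build (cycle i) (@boundaries i) (boundaries_zmod_closed i).

Definition reduced_homology (i : int) : zmodType := Quotient.quot (@boundaries i).

End ReducedHomology.

Section Hypercube.
Variable n : nat.

Definition hypercube_vertex : finType := {ffun 'I_n -> bool}.

Definition hypercube_adj : rel hypercube_vertex :=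
  fun x y => #|[set k | x k != y k]| == 1%N.

Fact hypercube_adj_sym : symmetric hypercube_adj.
Proof.
move=> x y; rewrite /hypercube_adj.
by under eq_finset => k do rewrite eq_sym.
Qed.

Fact hypercube_adj_irr : irreflexive hypercube_adj.
Proof.
move=> x; rewrite /hypercube_adj.
by under eq_finset => k do rewrite eqxx; rewrite (eqP (_ : finset _ == set0)%bool) ?cards0.
Qed.

Fact hypercube_adj_conn x y : connect hypercube_adj x y.
Proof.
move: {2}_.+1 (ltnSn #|[set k | x k != y k]|) => m; elim: m x => // m IH x lem.
have [/eqP|[k kP]] := set_0Vmem [set k | x k != y k].
  rewrite -subset0 => /subsetP e0; suff -> : x = y by exact: connect0.
  by apply/ffunP => k; apply/eqP; apply/negPn/negP => h; have := e0 k; rewrite !inE h => /(_ isT).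
pose z : hypercube_vertex := [ffun j => if j == k then y k else x j].
apply: (@connect_trans _ _ z).
  apply: connect1; rewrite /hypercube_adj.
  apply/cards1P; exists k; apply/setP => j; rewrite !inE ffunE.
  by case: (eqVneq j k) => [->|_]; [move: kP; rewrite inE | rewrite eqxx].
apply: IH; apply: leq_trans (_ : (#|[set k | x k != y k]| <= m)%N); last by [].
apply/proper_card/properP; split.
  by apply/subsetP => j; rewrite !inE ffunE; case: (eqVneq j k) => [->|//]; rewrite eqxx.
by exists k => //; rewrite inE ffunE !eqxx.
Qed.

Definition hypercube : conn_graph :=
  ConnGraph hypercube_adj_sym hypercube_adj_irr hypercube_adj_conn.

End Hypercube.

(* Main.v *)
From HB Require Import structures.
From mathcomp Require Import boolp reals.
From mathcomp Require Import all_boot all_order all_algebra.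
From mathcomp Require Import generic_quotient ring_quotient zify ring lra.
Require Import Defs.

Set Implicit Arguments.
Unset Strict Implicit.
Unset Printing Implicit Defensive.

Import Order.TTheory GRing.Theory Num.Theory.
Local Open Scope ring_scope.

(** A set is a simplex iff it lies in N(a) ∪ N(b) for some edge ab, where N denotes
    open neighbourhoods. Call a set a star if it lies in a closed neighbourhood N[v].
    Classes are killed by coning and detected by cochains modulo 2.

    Degrees at least 5. A simplex with at least five vertices contained in the
    neighbourhoods of two edges lies, up to one vertex, in N[v] for a common end
    v. So the part of a cycle carried by one edge ab has its boundary among such
    sets, and coning from a moves the cycle to them. There the centre v is unique
    and coning from v kills the cycle.

    Degrees at most 2. Coning from the odd end of a carrying edge, and then, for
    every pair at distance 3, from a chosen vertex between them, makes a cycle a sum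
    of stars. The vertices of a star can be pushed one by one along a coordinate
    direction without leaving the neighbourhood of an edge, so the cycle is pushed
    to a point.

    Degree 4. The vertices can be coloured with six colours, in terms of three
    coordinates, so that no simplex has all six. This maps the complex to the
    boundary of a 5-simplex, and it maps the boundary of the simplex on the six
    vertices of the 3-cube other than 000 and 111 isomorphically.

    Degree 3. Four coordinates, read as signs, map every simplex into an open half
    space of R^4, hence the complex to the complement of the origin. The winding
    number modulo 2, which counts the simplices whose cone contains a fixed generic
    vector, is 1 on a cross-polytope formed by four antipodal pairs. *)

Lemma pick_Some (T : finType) (P : pred T) x : [pick y | P y] = Some x -> P x.
Proof. by case: pickP => // y Py [<-]. Qed.

Lemma pick_None (T : finType) (P : pred T) : [pick y | P y] = None -> P =1 xpred0.
Proof. by case: pickP. Qed.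

Lemma pick_neq (T : finType) (P : pred T) x z :
  [pick y | P y] != Some z -> P x -> exists2 y, P y & y != z.
Proof.
case: pickP => [y Py|P0]; last by rewrite P0.
by rewrite (inj_eq Some_inj); exists y.
Qed.

(** * Cones, boundaries and homologous chains *)

Section ChainOperators.
Variable V : finType.
Implicit Types (s t : {set V}) (v w : V) (c d : chain V) (F P : {set V} -> Prop).

Definition facet_sign s v : int := (-1) ^+ vertex_position s v.

Definition contract v c : chain V :=
  [ffun t : {set V} => if v \in t then 0 else facet_sign t v * c (v |: t)].

Definition cone v c : chain V :=
  [ffun s : {set V} => if v \in s then facet_sign s v * c (s :\ v) else 0].

Definition restrict (A : pred {set V}) c : chain V :=
  [ffun s : {set V} => if A s then c s else 0].

Definition supported P c := forall s, c s != 0 -> P s.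

Definition homologous F c d := exists2 b, supported F b & bdry b = c - d.

Definition facet t s := (t \subset s) && (#|s| == #|t|.+1).

Lemma chainBE c d s : (c - d) s = c s - d s.
Proof. by rewrite !ffunE. Qed.

Lemma facet_sign_sqr s v : facet_sign s v * facet_sign s v = 1.
Proof. by rewrite -expr2 sqrr_sign. Qed.

Lemma facet_sign_neq0 s v : facet_sign s v != 0.
Proof. by rewrite signr_eq0. Qed.

Lemma facet_signU1 s v : facet_sign (v |: s) v = facet_sign s v.
Proof.
congr (_ ^+ _); apply: eq_card => w; rewrite !inE.
by case: eqP => [->|//]; rewrite ltnn !andbF.
Qed.

Lemma facet_signD1 s v : facet_sign (s :\ v) v = facet_sign s v.
Proof.
congr (_ ^+ _); apply: eq_card => w; rewrite !inE.
by case: eqP => [->|//]; rewrite ltnn !andbF.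
Qed.

Lemma facet_signU1_other s v w : w \notin s ->
  facet_sign (w |: s) v = (-1) ^+ (enum_rank w < enum_rank v)%N * facet_sign s v.
Proof.
move=> ws; rewrite /facet_sign -exprD; congr (_ ^+ _); rewrite /vertex_position.
case wv: (enum_rank w < enum_rank v)%N => /=.
  rewrite (cardsD1 w) !inE eqxx wv /=; congr (_ + _)%N; apply: eq_card => u.
  by rewrite !inE; case: eqP => [->|//]; rewrite (negPf ws).
rewrite add0n; apply: eq_card => u; rewrite !inE.
by case: eqP => [->|//]; rewrite wv !andbF.
Qed.

Lemma enum_rank_sign_anti v w : v != w ->
  (-1) ^+ (enum_rank w < enum_rank v)%N
    = - (-1) ^+ (enum_rank v < enum_rank w)%N :> int.
Proof.
move=> vw; case: ltngtP => [||/ord_inj/enum_rank_inj vw']; rewrite ?expr1 ?expr0 ?opprK //.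
by rewrite vw' eqxx in vw.
Qed.

Lemma facet_sign_exchange s v w : v != w -> v \notin s -> w \notin s ->
  facet_sign s v * facet_sign (v |: s) w = - (facet_sign s w * facet_sign (w |: s) v).
Proof.
by move=> vw vs ws; rewrite !facet_signU1_other // (enum_rank_sign_anti vw); ring.
Qed.

Lemma contract_is_zmod_morphism v : zmod_morphism (contract v).
Proof.
move=> c d; apply/ffunP => t; rewrite !ffunE.
by case: ifP => _; rewrite ?subr0 // mulrBr.
Qed.
HB.instance Definition _ v := GRing.isZmodMorphism.Build (chain V) (chain V)
  (contract v) (contract_is_zmod_morphism v).

Lemma cone_is_zmod_morphism v : zmod_morphism (cone v).
Proof.
move=> c d; apply/ffunP => t; rewrite !ffunE.
by case: ifP => _; rewrite ?subr0 // mulrBr.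
Qed.
HB.instance Definition _ v := GRing.isZmodMorphism.Build (chain V) (chain V)
  (cone v) (cone_is_zmod_morphism v).

Lemma bdryE c : bdry c = \sum_v contract v c.
Proof.
apply/ffunP => t; rewrite ffunE sum_ffunE.
transitivity (\sum_v \sum_(s : {set V} | (v \in s) && (s :\ v == t))
  facet_sign s v * c s); first by rewrite (exchange_big_dep xpredT).
apply: eq_bigr => v _; rewrite ffunE; case: ifP => vt.
  rewrite big1 // => s /andP[vs /eqP st].
  by rewrite -st !inE eqxx in vt.
rewrite (big_pred1 (v |: t)) ?facet_signU1 // => s /=; apply/andP/eqP => [[vs /eqP <-]|->].
  by rewrite setD1K.
by rewrite !inE eqxx setU1K // vt.
Qed.

Lemma contract_anti v w c : contract v (contract w c) = - contract w (contract v c).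
Proof.
apply/ffunP => t; rewrite !ffunE !inE.
have [->|vw] := eqVneq v w.
  by case: ifP; rewrite ?mulr0 oppr0.
rewrite /=.
case: ifPn => vt; case: ifPn => wt; rewrite ?mulr0 ?oppr0 //.
by rewrite !mulrA facet_sign_exchange // mulNr setUCA.
Qed.

Lemma contract_cone v w c :
  contract w (cone v c) = (if w == v then c else 0) - cone v (contract w c).
Proof.
apply/ffunP => t; have [->|vw] := eqVneq w v; rewrite !ffunE !inE ?eqxx /=.
  rewrite facet_signD1; case: ifPn => vt.
    by rewrite setD1K // mulrA facet_sign_sqr mul1r subrr.
  by rewrite setU1K // facet_signU1 mulrA facet_sign_sqr mul1r subr0.
rewrite eq_sym (negPf vw) /= sub0r.
case: ifPn => wt; case: ifPn => vt; rewrite ?mulr0 ?oppr0 //.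
have -> : (w |: t) :\ v = w |: t :\ v.
  by apply/setP => u; rewrite !inE; case: (eqVneq u v) => [->|//]; rewrite eq_sym (negPf vw).
rewrite !mulrA -mulNr; congr (_ * _).
rewrite -(facet_signD1 t v) -{1 2}(setD1K vt) setUCA facet_signU1.
have vt' : v \notin t :\ v by rewrite !inE eqxx.
have wt' : w \notin t :\ v by rewrite !inE (negPf wt) andbF.
rewrite (facet_signU1_other w vt') (facet_signU1_other v wt') (enum_rank_sign_anti vw).
by case: (_ < _)%N; rewrite ?expr0 ?expr1; ring.
Qed.

Lemma bdry_bdry c : bdry (bdry c) = 0.
Proof.
have bdry2N : bdry (bdry c) = - bdry (bdry c).
  rewrite {1}(bdryE c) raddf_sum /=; under eq_bigr do rewrite bdryE.
  rewrite (bdryE (bdry c)) -sumrN; apply: eq_bigr => w _.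
  rewrite (bdryE c) raddf_sum /= -sumrN; apply: eq_bigr => v _.
  exact: contract_anti.
by apply/ffunP => t; move/ffunP/(_ t): bdry2N; rewrite !ffunE; lia.
Qed.

Lemma bdry_cone v c : bdry (cone v c) = c - cone v (bdry c).
Proof.
rewrite !bdryE raddf_sum /=; under eq_bigr do rewrite contract_cone.
by rewrite sumrB -big_mkcond big_pred1_eq.
Qed.

Lemma facetU1 t w : w \notin t -> facet t (w |: t).
Proof. by move=> wt; rewrite /facet subsetUr cardsU1 wt eqxx. Qed.

Lemma facet_sub t s : facet t s -> t \subset s.
Proof. by case/andP. Qed.

Lemma card_facet t s : facet t s -> #|s| = #|t|.+1.
Proof. by case/andP => _ /eqP. Qed.

Lemma facetP t s : facet t s -> exists2 v, v \in s & t = s :\ v.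
Proof.
move=> /andP[ts /eqP st]; have /properP[_ [v vs vt]] : t \proper s.
  by rewrite properEcard ts st ltnSn.
exists v => //; apply/eqP; rewrite eqEcard subsetD1 ts vt /=.
by move: st; rewrite (cardsD1 v) vs add1n => -[->].
Qed.

Lemma bdry_supp c t : bdry c t != 0 -> exists2 s, facet t s & c s != 0.
Proof.
apply: contra_neqP => nex; rewrite bdryE sum_ffunE big1 // => w _; rewrite ffunE.
case: ifPn => // wt; have [->|nz] := eqVneq (c (w |: t)) 0; first by rewrite mulr0.
by case: nex; exists (w |: t); first exact: facetU1.
Qed.

Lemma eq_bdry_at c d t : (forall s, facet t s -> c s = d s) -> bdry c t = bdry d t.
Proof.
move=> cd; rewrite !bdryE !sum_ffunE; apply: eq_bigr => w _; rewrite !ffunE.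
by case: ifPn => // /facetU1/cd ->.
Qed.

Lemma cone_supp v c s : cone v c s != 0 -> v \in s /\ c (s :\ v) != 0.
Proof.
by rewrite ffunE; case: ifP => vs; rewrite ?eqxx // mulf_eq0 (negPf (facet_sign_neq0 _ _)).
Qed.

Lemma restrict_supp A c s : restrict A c s != 0 -> A s /\ c s != 0.
Proof. by rewrite ffunE; case: ifP => // _; rewrite eqxx. Qed.

Lemma sum_supp (T : finType) (f : T -> chain V) s :
  (\sum_l f l) s != 0 -> exists l, f l s != 0.
Proof.
rewrite sum_ffunE => nz; apply/existsP; apply: contra_neqT nz => /existsPn z.
by rewrite big1 // => l _; apply/eqP; rewrite -[_ == _]negbK z.
Qed.

Lemma supportedW P F c : (forall s, P s -> F s) -> supported P c -> supported F c.
Proof. by move=> PF Pc s /Pc/PF. Qed.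

Lemma supportedD P c d : supported P c -> supported P d -> supported P (c + d).
Proof.
move=> cP dP s; rewrite ffunE; have [->|/cP//] := eqVneq (c s) 0.
by rewrite add0r; apply: dP.
Qed.

Lemma homologous_refl F c : homologous F c c.
Proof. by exists 0; [move=> s; rewrite ffunE eqxx | rewrite raddf0 subrr]. Qed.

Lemma homologous_trans F d c e : homologous F c d -> homologous F d e -> homologous F c e.
Proof.
move=> [b bF bE] [b' bF' bE']; exists (b + b'); first exact: supportedD.
by rewrite raddfD /= bE bE' addrA subrK.
Qed.

Lemma homologousW P F c d : (forall s, P s -> F s) -> homologous P c d -> homologous F c d.
Proof. by move=> PF [b /(supportedW PF) bF bE]; exists b. Qed.

Lemma homologous_bdry F c d : homologous F c d -> bdry c = bdry d.
Proof. by case=> b _ bE; apply/eqP; rewrite -subr_eq0 -raddfB /= -bE bdry_bdry. Qed.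

Lemma cone_bounds_cycle F v c : bdry c = 0 -> (forall s, c s != 0 -> F (v |: s)) ->
  homologous F c 0.
Proof.
move=> cyc coneF; exists (cone v c); last by rewrite bdry_cone cyc raddf0.
by move=> s /cone_supp[vs /coneF]; rewrite setD1K.
Qed.

(* Coning off the part of [c] with label [l] from [apex l] replaces it by the
   cone over its boundary, which lives on the facets where labels change. *)
Lemma cone_off_cycle (T : finType) (lab : {set V} -> option T) (apex : T -> V) F P c :
  bdry c = 0 ->
  (forall s l, c s != 0 -> lab s = Some l -> F (apex l |: s)) ->
  (forall s, c s != 0 -> lab s = None -> P s) ->
  (forall s s' t l, c s != 0 -> lab s = Some l -> facet t s ->
    c s' != 0 -> lab s' != Some l -> facet t s' -> apex l \notin t -> P (apex l |: t)) ->
  exists2 d, supported P d & homologous F c d.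
Proof.
move=> cyc coneF unlabelledP changeP.
pose part l := restrict (fun s => lab s == Some l) c.
pose b := \sum_l cone (apex l) (part l).
have c_sub_bdry : c - bdry b =
    restrict (fun s => lab s == None) c + \sum_l cone (apex l) (bdry (part l)).
  rewrite raddf_sum /=; under eq_bigr do rewrite bdry_cone.
  rewrite sumrB opprB addrCA addrC; congr (_ + _).
  apply/ffunP => s; rewrite !ffunE sum_ffunE.
  case labs : (lab s) => [l|]; last first.
    by rewrite eqxx big1 ?subr0 // => l _; rewrite ffunE labs.
  rewrite (bigD1 l) //= ffunE labs eqxx big1 ?addr0 ?subrr // => l' ll'.
  by rewrite ffunE labs (inj_eq Some_inj) eq_sym (negPf ll').
exists (c - bdry b); last first.
  exists b; last by rewrite subKr.
  move=> s /sum_supp[l /cone_supp[ls /restrict_supp[/eqP labs cs]]].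
  by rewrite -(setD1K ls); apply: coneF cs labs.
rewrite c_sub_bdry; apply: supportedD => s.
  by move=> /restrict_supp[/eqP labs /unlabelledP]; apply.
move=> /sum_supp[l /cone_supp[ls nz]]; rewrite -(setD1K ls); set t := s :\ apex l in nz *.
have [s' ts' /restrict_supp[/eqP labs' cs']] := bdry_supp nz.
have [s'' /and3P[ts'' cs'' labs'']] :
    exists s'', [&& facet t s'', c s'' != 0 & lab s'' != Some l].
  apply/existsP; apply: contra_neqT nz => /existsPn same.
  rewrite (@eq_bdry_at _ c) ?cyc ?ffunE // => r tr; rewrite ffunE.
  by move: (same r); rewrite tr /= negb_and !negbK; case: (lab r == _) => //; rewrite orbF => /eqP.
by apply: (changeP s' s''); rewrite // !inE eqxx.
Qed.

Lemma fold_cycle F (p : V -> V) c :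
  (forall s t, F s -> t \subset s -> F t) ->
  (forall s x, F s -> x \in s -> F (p x |: s)) ->
  (forall x, p (p x) = p x) ->
  supported F c -> bdry c = 0 ->
  exists2 d, supported (fun s => F s /\ {in s, forall x, p x = x}) d & homologous F c d.
Proof.
move=> Fsub Fp pp Fc cyc.
suff fold_seq (l : seq V) : exists2 d,
    supported (fun s => F s /\ {in s, forall x, x \in l -> p x = x}) d & homologous F c d.
  have [d dP cd] := fold_seq (enum V); exists d => // s /dP[Fs ps].
  by split=> // x xs; apply: ps; rewrite ?mem_enum.
elim: l => [|y l [d dP cd]]; first by exists c; [move=> s /Fc | exact: homologous_refl].
have [py|py] := eqVneq (p y) y.
  exists d => // s /dP[Fs ps]; split=> // x xs.
  by rewrite inE => /predU1P[->//|]; apply: ps.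
have cycd : bdry d = 0 by rewrite -(homologous_bdry cd).
pose lab s := if y \in s then Some tt else None.
have labP s l' : lab s = Some l' -> y \in s by rewrite /lab; case: ifP.
have [|||e eP de] := @cone_off_cycle _ lab (fun=> p y) F
    (fun s => F s /\ {in s, forall x, x \in y :: l -> p x = x}) d cycd.
- by move=> s l' /dP[Fs _] /labP; apply: Fp.
- move=> s /dP[Fs ps]; rewrite /lab; case: ifPn => // ys _; split=> // x xs.
  by rewrite inE => /predU1P[xy|]; [rewrite -xy xs in ys | apply: ps].
- move=> s s' t [] /dP[Fs ps] /labP ys /facet_sub ts _ labs' /facet_sub ts' _.
  have yt : y \notin t by apply: contra labs' => /(subsetP ts') ys'; rewrite /lab ys'.
  split; first by apply: Fsub (Fp _ _ Fs ys) _; rewrite setUS.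
  move=> x; rewrite !inE => /predU1P[->|xt]; first by rewrite pp.
  by move=> /predU1P[xy|]; [rewrite -xy xt in yt | apply: ps (subsetP ts _ xt)].
by exists e => //; apply: homologous_trans cd de.
Qed.

Lemma homologous0_card F c m : supported (fun s => #|s| = m) c -> homologous F c 0 ->
  exists2 b, supported (fun s => F s /\ #|s| = m.+1) b & bdry b = c.
Proof.
move=> cm [b bF bE]; rewrite subr0 in bE; exists (restrict (fun s => #|s| == m.+1) b).
  by move=> s /restrict_supp[/eqP sm /bF].
apply/ffunP => t; rewrite -bE; have [tm|tm] := eqVneq #|t| m.
  by apply: eq_bdry_at => s /card_facet; rewrite ffunE tm => ->; rewrite eqxx.
have -> : bdry b t = 0 by apply/eqP; rewrite bE; apply: contraNT tm => /cm ->.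
apply/eqP; apply: contraNT tm => /bdry_supp[s /card_facet sE /restrict_supp[]].
by rewrite sE eqSS.
Qed.

End ChainOperators.

(** * Cylinders in the cube *)

Section Cube.
Variable n : nat.
Local Notation vtx := (hypercube_vertex n).
Local Notation adj := (@hypercube_adj n).
Implicit Types (v w x y a b : vtx) (s t : {set vtx}) (i j k : 'I_n) (e f : vtx * 'I_n).

Definition flip v k : vtx := [ffun i => v i (+) (i == k)].

Definition diff x y : {set 'I_n} := [set k | x k != y k].

Definition hdist x y := #|diff x y|.

Definition origin : vtx := [ffun=> false].

Definition parity v := odd (hdist v origin).

Definition nbrs v : {set vtx} := [set x | adj v x].

Definition ball v : {set vtx} := [set x | (hdist v x <= 1)%N].

(* The product of the direction [k] with a closed unit ball of the orthogonal facet. *)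
Definition cylinder v k : {set vtx} := [set x | (#|diff v x :\ k| <= 1)%N].

Definition cube_face s : Prop := exists v k, s \subset cylinder v k.

Lemma hdistxx x : hdist x x = 0%N.
Proof. by apply/eqP; rewrite cards_eq0 -subset0; apply/subsetP => k; rewrite inE eqxx. Qed.

Lemma hdist_eq0 x y : (hdist x y == 0%N) = (x == y).
Proof.
apply/idP/eqP => [|->]; last by rewrite hdistxx.
rewrite cards_eq0 => /eqP/setP xy; apply/ffunP => k.
by have := xy k; rewrite !inE => /negbFE/eqP.
Qed.

Lemma adjE x y : adj x y = (hdist x y == 1%N).
Proof. by []. Qed.

Lemma adjC x y : adj x y = adj y x.
Proof. exact: hypercube_adj_sym. Qed.

Lemma diff_flipD1 x y k : diff (flip x k) y :\ k = diff x y :\ k.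
Proof. by apply/setP => i; rewrite !inE ffunE; case: (i == k); rewrite ?addbF. Qed.

Lemma hdistE x y k : hdist x y = ((x k != y k) + #|diff x y :\ k|)%N.
Proof. by rewrite /hdist (cardsD1 k) inE. Qed.

Lemma hdist_flip x y k : hdist (flip x k) y = ((x k == y k) + #|diff x y :\ k|)%N.
Proof. by rewrite (hdistE _ _ k) diff_flipD1 ffunE eqxx; case: (x k) (y k) => [] []. Qed.

Lemma adj_flip v k : adj v (flip v k).
Proof.
rewrite adjC adjE hdist_flip eqxx (_ : diff v v = set0) ?set0D ?cards0 //.
by apply/eqP; rewrite -cards_eq0 [#|_|]hdistxx.
Qed.

Lemma adjP x y : reflect (exists k, y = flip x k) (adj x y).
Proof.
apply: (iffP idP) => [/cards1P[k xy]|[k ->]]; last exact: adj_flip.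
exists k; apply/ffunP => i; move/setP/(_ i): xy; rewrite !inE ffunE.
by case: (x i) (y i) (i == k) => [] [] [].
Qed.

Lemma parity_flip v k : parity (flip v k) = ~~ parity v.
Proof.
by rewrite /parity hdist_flip (hdistE v origin k) !oddD !oddb; case: (_ == _); case: odd.
Qed.

Lemma parity_adj x y : adj x y -> parity y = ~~ parity x.
Proof. by move=> /adjP[k ->]; rewrite parity_flip. Qed.

Lemma in_ball v x : (x \in ball v) = (x == v) || adj v x.
Proof. by rewrite inE adjE eq_sym -hdist_eq0; case: hdist => [|[]]. Qed.

Lemma ball_sub_cylinder v k : ball v \subset cylinder v k.
Proof. by apply/subsetP => x; rewrite !inE (hdistE v x k); apply: leq_trans; exact: leq_addl. Qed.

Lemma cylinder_flip v k : cylinder (flip v k) k = cylinder v k.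
Proof. by apply/setP => x; rewrite !inE diff_flipD1. Qed.

Lemma cylinderE v k : cylinder v k = nbrs v :|: nbrs (flip v k).
Proof.
apply/setP => x; rewrite !inE !adjE hdist_flip (hdistE v x k).
by case: (v k == x k); case: #|_| => [|[|m]].
Qed.

Lemma card_nbrsI v w : v != w -> (#|nbrs v :&: nbrs w| <= 2)%N.
Proof.
move=> vw; have common i : flip v i \in nbrs w -> v i != w i /\ hdist v w = 2%N.
  rewrite inE adjC adjE hdist_flip (hdistE v w i) => /eqP.
  case: (eqVneq (v i) (w i)) => /= [viwi d0|_]; last by rewrite add0n => ->.
  case/eqP: vw; apply/eqP; rewrite -hdist_eq0 (hdistE v w i) viwi eqxx; exact/eqP/succn_inj.
have [->|[x0]] := set_0Vmem (nbrs v :&: nbrs w); first by rewrite cards0.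
rewrite 2!inE => /andP[/adjP[i ->] /common[_ <-]].
apply: leq_trans (leq_imset_card (flip v) _); apply/subset_leq_card/subsetP => x.
by rewrite 2!inE => /andP[/adjP[j ->] /common[vwj _]]; rewrite imset_f // inE.
Qed.

Lemma nbrsI_parity v w : parity v != parity w -> nbrs v :&: nbrs w = set0.
Proof.
move=> vw; apply/eqP; rewrite -subset0; apply/subsetP => x.
rewrite 3!inE => /andP[/parity_adj vx /parity_adj]; rewrite vx.
by move: vw; case: (parity v); case: (parity w).
Qed.

Lemma card_ballI v w : v != w -> (#|ball v :&: ball w| <= 2)%N.
Proof.
move=> vw; have [pvw|pvw] := eqVneq (parity v) (parity w).
  apply: leq_trans (card_nbrsI vw); apply/subset_leq_card/subsetP => x.
  rewrite in_setI !in_ball !inE => /andP[].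
  move=> /predU1P[->|vx] /predU1P[xw|wx]; rewrite ?vx ?wx //.
  - by rewrite xw eqxx in vw.
  - by move: (parity_adj wx); rewrite pvw; case: (parity w).
  - by move: (parity_adj vx); rewrite xw pvw; case: (parity w).
apply: leq_trans (_ : #|[set v; w]| <= 2)%N; last by rewrite cards2; lia.
apply/subset_leq_card/subsetP => x; rewrite in_setI !in_ball !inE.
have /setP/(_ x) := nbrsI_parity pvw.
by rewrite !inE => vwx /andP[/orP[->//|vx] /orP[->|wx]]; [rewrite orbT | rewrite vx wx in vwx].
Qed.

(** * Degrees at least 5 *)

(* The edge is represented by its even end and its direction. *)
Definition carries e s := ~~ parity e.1 && (s \subset cylinder e.1 e.2).

Definition odd_end e := flip e.1 e.2.

Definition centred v s := (#|s :\: ball v| <= 1)%N.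

Definition near_star v s :=
  [exists e, [&& carries e s, v \in [set e.1; odd_end e] & centred v s]].

Lemma cube_face_carrier s : cube_face s -> exists e, carries e s.
Proof.
move=> [v [k sv]]; case pv : (parity v); last by exists (v, k); rewrite /carries pv.
by exists (flip v k, k); rewrite /carries /= parity_flip pv cylinder_flip.
Qed.

Lemma carries_face e s : carries e s -> cube_face s.
Proof. by move=> /andP[_ se]; exists e.1, e.2. Qed.

Lemma carriesS e s t : carries e s -> t \subset s -> carries e t.
Proof. by move=> /andP[pe se] ts; rewrite /carries pe (subset_trans ts). Qed.

Lemma ball_end_sub_cylinder e v : v \in [set e.1; odd_end e] -> ball v \subset cylinder e.1 e.2.
Proof.
rewrite !inE => /orP[]/eqP->; first exact: ball_sub_cylinder.
by rewrite -cylinder_flip ball_sub_cylinder.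
Qed.

Lemma carries_coneU1 e v s : carries e s -> v \in [set e.1; odd_end e] -> carries e (v |: s).
Proof.
move=> /andP[pe se] ve; rewrite /carries pe subUset se andbT sub1set.
by apply: (subsetP (ball_end_sub_cylinder ve)); rewrite in_ball eqxx.
Qed.

Lemma centredS v s t : centred v s -> t \subset s -> centred v t.
Proof. by move=> vs ts; apply: leq_trans vs; apply/subset_leq_card/setSD. Qed.

Lemma centredU1 v s x : centred v s -> x \in ball v -> centred v (x |: s).
Proof.
move=> vs xv; rewrite /centred setDUl (_ : [set x] :\: ball v = set0) ?set0U //.
by apply/eqP; rewrite setD_eq0 sub1set.
Qed.

Lemma centre_unique v w s : centred v s -> centred w s -> (5 <= #|s|)%N -> v = w.
Proof.
move=> vs ws s5; apply/eqP; apply: contraLR s5 => /card_ballI vw; rewrite -ltnNge.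
have := cardsID (ball v) s; have := cardsID (ball w) (s :&: ball v).
have : (#|(s :&: ball v) :&: ball w| <= 2)%N.
  by apply: leq_trans vw; apply/subset_leq_card; rewrite -setIA subsetIr.
have : (#|(s :&: ball v) :\: ball w| <= 1)%N.
  by apply: leq_trans ws; apply/subset_leq_card/setSD/subsetIl.
by move: vs; rewrite /centred; lia.
Qed.

Lemma near_star_face v s : near_star v s -> cube_face s.
Proof. by move=> /existsP[e /and3P[/carries_face]]. Qed.

Lemma near_star_coneU1 v s : near_star v s -> near_star v (v |: s).
Proof.
move=> /existsP[e /and3P[es ve vs]]; apply/existsP; exists e.
by rewrite carries_coneU1 // ve centredU1 // in_ball eqxx.
Qed.

Lemma centred_common_end a b d s : adj a b -> adj a d -> b != d ->
  s \subset nbrs a :|: nbrs b :&: nbrs d -> centred a s.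
Proof.
move=> ab ad bd /subsetP s_sub.
apply: leq_trans (_ : #|(nbrs b :&: nbrs d) :\ a| <= 1)%N; last first.
  by have := card_nbrsI bd; rewrite (cardsD1 a) !inE adjC ab adjC ad; lia.
apply/subset_leq_card/subsetP => x; rewrite in_setD in_ball negb_or => /andP[/andP[xa ax]].
by move=> /s_sub; rewrite !inE (negPf ax) xa.
Qed.

Lemma cylinderI e f : ~~ parity e.1 -> ~~ parity f.1 ->
  cylinder e.1 e.2 :&: cylinder f.1 f.2 =
    (nbrs e.1 :&: nbrs f.1) :|: (nbrs (odd_end e) :&: nbrs (odd_end f)).
Proof.
move=> pe pf; rewrite !cylinderE !(setIUl, setIUr) -!/(odd_end _).
rewrite [nbrs (odd_end e) :&: nbrs f.1]nbrsI_parity ?[nbrs e.1 :&: nbrs (odd_end f)]nbrsI_parity.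
- by rewrite setU0 set0U.
- by rewrite parity_flip (negPf pe) (negPf pf).
- by rewrite parity_flip (negPf pe) (negPf pf).
Qed.

(* Distinct open neighbourhoods share at most two vertices, so two edges carrying
   five common vertices must have a common end, which is then a centre. *)
Lemma two_carriers_centred e f s : carries e s -> carries f s -> e != f -> (5 <= #|s|)%N ->
  exists2 v, v \in [set e.1; odd_end e] & centred v s.
Proof.
move=> /andP[pe se] /andP[pf sf] ef s5.
have := cylinderI pe pf; set A := nbrs e.1 :&: _; set B := nbrs (odd_end e) :&: _ => cylI.
have sAB : s \subset A :|: B by rewrite -cylI subsetI se sf.
have [e1f1|e1f1] := eqVneq e.1 f.1.
  have ends_neq : odd_end e != odd_end f.
    apply: contra_neq ef => odd_eq; apply/eqP.
    rewrite -pair_eqE /= e1f1 eqxx /=; apply/eqP.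
    move/ffunP/(_ e.2): odd_eq; rewrite !ffunE e1f1 eqxx.
    by case: (f.1 e.2); case: eqP.
  exists e.1; first exact: set21.
  apply: (centred_common_end _ _ ends_neq); first exact: adj_flip.
    by rewrite e1f1 adj_flip.
  by apply: subset_trans sAB _; rewrite setSU // subsetIl.
have [e2f2|e2f2] := eqVneq (odd_end e) (odd_end f).
  exists (odd_end e); first exact: set22.
  apply: (@centred_common_end _ e.1 f.1) => //; first by rewrite adjC adj_flip.
    by rewrite e2f2 adjC adj_flip.
  by apply: subset_trans sAB _; rewrite setUC setSU // subsetIl.
have AB4 : (#|A :|: B| <= 4)%N.
  by rewrite cardsU (leq_trans (leq_subr _ _)) // (leq_add (card_nbrsI e1f1) (card_nbrsI e2f2)).
by have := leq_trans (subset_leq_card sAB) AB4; rewrite leqNgt s5.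
Qed.

Lemma cycle_to_near_stars (c : chain vtx) : bdry c = 0 ->
  supported (fun s => cube_face s /\ 6 <= #|s|)%N c ->
  exists2 d, supported (fun s => (exists v, near_star v s) /\ 6 <= #|s|)%N d &
    homologous cube_face c d.
Proof.
move=> cyc cF.
pose lab s := [pick e | ~~ [exists v, near_star v s] && carries e s].
apply: (@cone_off_cycle _ _ lab (fun e => e.1)) => // [s e _|s|s s' t e].
- by move=> /pick_Some/andP[_ es]; apply: carries_face (carries_coneU1 es (set21 _ _)).
- move=> /cF[/cube_face_carrier[e es] s6] /pick_None/(_ e); rewrite es andbT.
  by move=> /negbFE/existsP.
move=> /cF[_ s6] /pick_Some/andP[_ es] ts /cF[/cube_face_carrier[g gs'] _] labs' ts' et.
have t5 : (5 <= #|t|)%N by move: s6; rewrite (card_facet ts).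
have et' := carriesS es (facet_sub ts).
split; last by rewrite cardsU1 et.
suff [v ve vt] : exists2 v, v \in [set e.1; odd_end e] & centred v t.
  exists v; apply/existsP; exists e; rewrite ve carries_coneU1 ?centredU1 ?set21 //.
  by rewrite in_ball; move: ve; rewrite !inE => /orP[]/eqP->; rewrite ?eqxx // adjC adj_flip orbT.
have [/existsP[w /existsP[f /and3P[fs' wf ws']]]|far] := boolP [exists v, near_star v s'].
  have [fe|fe] := eqVneq e f; first by exists w; [rewrite fe | apply: centredS ws' (facet_sub ts')].
  exact: two_carriers_centred et' (carriesS fs' (facet_sub ts')) fe t5.
have [|f /andP[_ fs'] fe] := pick_neq (x := g) labs'; first by rewrite far gs'.
by apply: two_carriers_centred et' (carriesS fs' (facet_sub ts')) _ t5; rewrite eq_sym.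
Qed.

Lemma near_stars_cycle_bounds (c : chain vtx) : bdry c = 0 ->
  supported (fun s => (exists v, near_star v s) /\ 6 <= #|s|)%N c ->
  homologous cube_face c 0.
Proof.
move=> cyc cN.
pose lab s := [pick v | near_star v s].
have [|s|s s' t v|d d0 cd] := @cone_off_cycle _ _ lab id cube_face (fun=> False) c cyc.
- by move=> s v _ /pick_Some/near_star_coneU1/near_star_face.
- by move=> /cN[[v vs] _] /pick_None/(_ v); rewrite vs.
- move=> /cN[_ s6] /pick_Some vs ts /cN[[w ws'] _] labs' ts' _.
  have [u us' /eqP] := pick_neq labs' ws'; apply.
  have t5 : (5 <= #|t|)%N by move: s6; rewrite (card_facet ts).
  have centred_of x r : near_star x r -> facet t r -> centred x t.
    by move=> /existsP[e /and3P[_ _ xr]] /facet_sub; apply: centredS.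
  exact: centre_unique (centred_of _ _ us' ts') (centred_of _ _ vs ts) t5.
suff <- : d = 0 by [].
by apply/ffunP => s; rewrite [RHS]ffunE; apply/eqP; apply: contraT => /d0.
Qed.

Lemma cycle_bounds_card_ge6 (c : chain vtx) : bdry c = 0 ->
  supported (fun s => cube_face s /\ 6 <= #|s|)%N c -> homologous cube_face c 0.
Proof.
move=> cyc cF; have [d dN cd] := cycle_to_near_stars cyc cF.
have cycd : bdry d = 0 by rewrite -(homologous_bdry cd).
exact: homologous_trans cd (near_stars_cycle_bounds cycd dN).
Qed.

End Cube.

(** * Degrees at most 2 *)

Section LowDegrees.
Variable n : nat.
Local Notation vtx := (hypercube_vertex n).
Local Notation adj := (@hypercube_adj n).
Implicit Types (v w x y a b : vtx) (s t : {set vtx}) (i j k : 'I_n) (e : vtx * 'I_n).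

Definition in_star s := [exists v, s \subset ball v].

(* The vertices of a path of length 3 from [y] to [x], without the third one. *)
Definition bent_path y x s := [&& ~~ parity y, hdist y x == 3%N &
  [exists j, (y j != x j) && (s == [set y; flip y j; x])]].

Definition via y x := if [pick i | y i != x i] is Some i then flip y i else y.

Lemma in_starP v s : s \subset ball v -> in_star s.
Proof. by move=> sv; apply/existsP; exists v. Qed.

Lemma hdist_flip_toward y x j : y j != x j -> hdist y x = (hdist (flip y j) x).+1.
Proof. by rewrite (hdistE y x j) hdist_flip => /negPf ->. Qed.

Lemma parity_hdist x y : odd (hdist x y) = parity x (+) parity y.
Proof.
move: {2}(hdist x y) (leqnn (hdist x y)) => m; elim: m x => [|m IH] x.
  by rewrite leqn0 hdist_eq0 => /eqP->; rewrite hdistxx addbb.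
case: (set_0Vmem (diff x y)) => [xy0|[k]].
  by have -> : x = y; [apply/eqP; rewrite -hdist_eq0 /hdist xy0 cards0 | rewrite hdistxx addbb].
rewrite inE => /hdist_flip_toward ->; rewrite ltnS oddS => /IH ->.
by rewrite parity_flip addNb negbK.
Qed.

Lemma hdist_triangle v x y : (hdist x y <= hdist v x + hdist v y)%N.
Proof.
apply: leq_trans (_ : #|diff v x :|: diff v y| <= _)%N; last by rewrite cardsU leq_subr.
apply/subset_leq_card/subsetP => k; rewrite !inE.
by case: (v k) (x k) (y k) => [] [] [].
Qed.

Lemma star_hdist s x y : in_star s -> x \in s -> y \in s -> (hdist x y <= 2)%N.
Proof.
move=> /existsP[v /subsetP sv] /sv + /sv; rewrite !inE => vx vy.
exact: leq_trans (hdist_triangle v x y) (leq_add vx vy).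
Qed.

Lemma bent_path_long_pair y x y' x' s : bent_path y' x' s -> y \in s -> x \in s ->
  ~~ parity y -> hdist y x = 3%N -> (y, x) = (y', x').
Proof.
move=> /and3P[py' /eqP yx' /existsP[j /andP[_ /eqP->]]]; rewrite !inE => ys xs py yx.
have px' : parity x' by have := parity_hdist y' x'; rewrite yx' (negPf py') /= => <-.
have yy' : y = y'.
  by case/orP: ys => [/orP[]|] /eqP yE //; move: py; rewrite yE ?parity_flip ?py' ?px'.
subst y'; congr (_, _); case/orP: xs => [/orP[]|] /eqP xE //.
  by move: yx; rewrite xE hdistxx.
by have := adj_flip y j; rewrite adjE -xE yx.
Qed.

Lemma viaP y x : hdist y x = 3%N -> exists2 i, y i != x i & via y x = flip y i.
Proof.
rewrite /via; case: pickP => [i yxi _|yx]; first by exists i.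
by rewrite /hdist (eq_card0 (A := diff y x)) // => k; rewrite inE yx.
Qed.

Lemma long_pair_common_nbr y x i j : hdist y x = 3%N -> y i != x i -> y j != x j ->
  exists a, [/\ adj a (flip y i), adj a (flip y j) & adj a x].
Proof.
move=> yx yxi yxj.
have [l li [yxl jil]] : exists2 l, l != i & y l != x l /\ (j = i \/ j = l).
  have [->|ji] := eqVneq j i; last by exists j => //; split=> //; right.
  have : (0 < #|diff y x :\ i|)%N by move: yx; rewrite (hdistE y x i) yxi add1n => -[->].
  by move=> /card_gt0P[l]; rewrite !inE => /andP[li yxl]; exists l => //; split=> //; left.
exists (flip (flip y i) l); rewrite adjC adj_flip; split=> //.
  case: jil => ->; first by rewrite adjC adj_flip.
  suff -> : flip (flip y i) l = flip (flip y l) i by rewrite adjC adj_flip.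
  by apply/ffunP => m; rewrite !ffunE addbAC.
move: yx; rewrite adjE (hdist_flip_toward yxi) (@hdist_flip_toward (flip y i) x l) => [[->]|] //.
by rewrite ffunE (negPf li) addbF.
Qed.

Lemma path_star_or_bent a b x y : ~~ parity a -> adj a b -> adj a x -> adj b y ->
  in_star (b |: [set y; x]) \/ bent_path y x (b |: [set y; x]).
Proof.
move=> pa ab ax adj_by; have bx2 : (hdist b x <= 2)%N.
  by apply: leq_trans (hdist_triangle a b x) _; move: ab ax; rewrite !adjE => /eqP-> /eqP->.
have yx3 : (hdist y x <= 3)%N.
  apply: leq_trans (hdist_triangle b y x) _; rewrite -(addn1 2) addnC leq_add //.
  by move: adj_by; rewrite adjE => /eqP->.
have py : ~~ parity y by rewrite (parity_adj adj_by) (parity_adj ab) negbK.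
have odd_yx : odd (hdist y x) by rewrite parity_hdist (negPf py) (parity_adj ax) pa.
have [yx|yx] := eqVneq (hdist y x) 3%N.
  right; rewrite /bent_path py yx eqxx /=; move: adj_by; rewrite adjC => /adjP[j bE].
  apply/existsP; exists j; rewrite bE setUCA setUA eqxx andbT.
  by move: yx bx2; rewrite bE hdist_flip (hdistE y x j); case: (y j == x j) => //=; lia.
left; apply: (@in_starP y); rewrite !subUset !sub1set !in_ball eqxx /= adjC adj_by orbT /=.
by rewrite adjE orbC; move: yx3 yx odd_yx; case: hdist => [|[|[|[]]]].
Qed.

Lemma cycle_to_bent_paths (c : chain vtx) : bdry c = 0 ->
  supported (fun s => cube_face s /\ #|s| <= 3)%N c ->
  exists2 d, supported (fun s => in_star s \/ exists p, bent_path p.1 p.2 s) d &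
    homologous (@cube_face n) c d.
Proof.
move=> cyc cF.
pose lab s := [pick e | ~~ in_star s && carries e s].
apply: (@cone_off_cycle _ _ lab (@odd_end n)) => // [s e _|s|s s' t e].
- by move=> /pick_Some/andP[_ es]; apply: carries_face (carries_coneU1 es (set22 _ _)).
- move=> /cF[/cube_face_carrier[e es] _] /pick_None/(_ e); rewrite es andbT.
  by move=> /negbFE; left.
move=> /cF[_ s3] /pick_Some/andP[_ es] ts _ _ _ _.
have t2 : (#|t| <= 2)%N by move: s3; rewrite (card_facet ts).
have /andP[pe] := carriesS es (facet_sub ts); rewrite cylinderE -/(odd_end e).
case: e pe {es} => a k /= pa tab; set b := flip a k.
have [ta|/subsetPn[y yt ya]] := boolP (t \subset ball a).
  by left; apply: (@in_starP a); rewrite subUset sub1set ta in_ball adj_flip orbT.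
have [tb|/subsetPn[x xt xb]] := boolP (t \subset ball b).
  by left; apply: (@in_starP b); rewrite subUset sub1set tb in_ball eqxx.
have adj_by : adj b y.
  have := subsetP tab y yt; rewrite !inE => /orP[ay|//].
  by rewrite in_ball ay orbT in ya.
have ax : adj a x.
  have := subsetP tab x xt; rewrite !inE => /orP[//|bx].
  by rewrite in_ball bx orbT in xb.
have -> : t = [set y; x].
  apply/esym/eqP; rewrite eqEcard subUset !sub1set yt xt cards2.
  by rewrite (leq_trans t2) //; case: eqVneq ya => [->|//]; rewrite in_ball ax orbT.
have [st|bp] := path_star_or_bent pa (adj_flip a k) ax adj_by; first by left.
by right; exists (y, x).
Qed.

Lemma bent_paths_to_stars (c : chain vtx) : bdry c = 0 ->
  supported (fun s => in_star s \/ exists p, bent_path p.1 p.2 s) c ->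
  exists2 d, supported in_star d & homologous (@cube_face n) c d.
Proof.
move=> cyc cB.
pose lab s := [pick p : vtx * vtx | bent_path p.1 p.2 s].
apply: (@cone_off_cycle _ _ lab (fun p => via p.1 p.2)) => //.
- move=> s [y x] _ /pick_Some/and3P[/= py /eqP yx /existsP[j /andP[yxj /eqP->]]].
  have [i yxi ->] := viaP yx; have [a [ai aj ax]] := long_pair_common_nbr yx yxi yxj.
  move: ai; rewrite adjC => /adjP[k aE]; exists (flip y i), k; rewrite cylinderE -aE.
  apply/subsetP => z; rewrite !inE => /orP[|/orP[/orP[]|]] /eqP->; rewrite ?aj ?ax ?orbT //.
    by rewrite aE adjC adj_flip orbT.
  by rewrite adjC adj_flip.
- by move=> s /cB[//|[p ps]] /pick_None/(_ p); rewrite ps.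
move=> s s' t [y x] _ /pick_Some/and3P[/= py /eqP yx /existsP[j /andP[yxj /eqP sE]]].
move=> /facet_sub ts /cB s'B labs' /facet_sub ts' _; rewrite sE in ts.
have [i yxi ->] := viaP yx; have [a [ai aj ax]] := long_pair_common_nbr yx yxi yxj.
have [yt|yt] := boolP (y \in t); last first.
  apply: (@in_starP a); rewrite subUset sub1set in_ball ai orbT /=.
  apply/subsetP => z zt; rewrite in_ball.
  have := subsetP ts z zt; rewrite !inE => /orP[/orP[]|] /eqP zE; rewrite zE ?aj ?ax ?orbT //.
  by rewrite -zE zt in yt.
have [xt|xt] := boolP (x \in t); last first.
  apply: (@in_starP y); rewrite subUset sub1set in_ball adj_flip orbT /=.
  apply/subsetP => z zt; rewrite in_ball.
  have := subsetP ts z zt; rewrite !inE => /orP[/orP[]|] /eqP zE;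
    rewrite zE ?eqxx ?adj_flip ?orbT //.
  by rewrite -zE zt in xt.
have ys' := subsetP ts' y yt; have xs' := subsetP ts' x xt.
case: s'B => [/star_hdist/(_ ys' xs')|[p ps']]; first by rewrite yx.
have [q qs' /eqP[]] := pick_neq labs' ps'.
by rewrite (bent_path_long_pair qs' ys' xs' py yx) -surjective_pairing.
Qed.

Definition zero_below (m : nat) s :=
  in_star s /\ {in s, forall x i, (i < m)%N -> x i = false}.

Definition clear k x : vtx := [ffun i => (i != k) && x i].

Lemma clear_cylinder v k x : (clear k x \in cylinder v k) = (x \in cylinder v k).
Proof.
rewrite !inE; congr (_ <= _)%N; apply: eq_card => i.
by rewrite !inE ffunE; case: eqP.
Qed.

Lemma cylinder_cleared v k x : x \in cylinder v k -> x k = false -> x \in ball (clear k v).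
Proof.
rewrite !inE => vx xk; rewrite (hdistE _ _ k) ffunE eqxx xk add0n.
apply: leq_trans vx; apply/subset_leq_card/subsetP => i.
by rewrite !inE ffunE; case: eqP.
Qed.

Lemma fold_coordinate (c : chain vtx) k : bdry c = 0 -> supported (zero_below k) c ->
  exists2 d, supported (zero_below k.+1) d & homologous (@cube_face n) c d.
Proof.
move=> cyc cZ.
pose F s := (exists v, s \subset cylinder v k) /\
  {in s, forall x (i : 'I_n), (i < k)%N -> x i = false}.
have [|||||d dF cd] := @fold_cycle _ F (clear k) c.
- move=> s t [[v sv] s0] ts; split; first by exists v; apply: subset_trans sv.
  by move=> x /(subsetP ts); apply: s0.
- move=> s x [[v sv] s0] xs; split.
    by exists v; rewrite subUset sv sub1set clear_cylinder (subsetP sv).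
  move=> y; rewrite !inE => /predU1P[-> i ik|]; last exact: s0.
  by rewrite ffunE (s0 x) // andbF.
- by move=> x; apply/ffunP => i; rewrite !ffunE; case: eqP.
- move=> s /cZ[/existsP[v sv] s0]; split=> //; exists v.
  exact: subset_trans sv (ball_sub_cylinder v k).
- exact: cyc.
exists d; last by apply: homologousW cd => s [[v sv] _]; exists v, k.
move=> s /dF[[[v sv] s0] cleared].
have xk0 x : x \in s -> x k = false by move=> /cleared <-; rewrite ffunE eqxx.
split; last first.
  move=> x xs i; rewrite ltnS leq_eqVlt => /predU1P[/ord_inj->|]; first exact: xk0.
  exact: s0.
apply: (@in_starP (clear k v)); apply/subsetP => x xs.
exact: cylinder_cleared (subsetP sv x xs) (xk0 x xs).
Qed.

Lemma star_cycle_bounds (c : chain vtx) : (0 < n)%N -> bdry c = 0 ->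
  supported in_star c -> homologous (@cube_face n) c 0.
Proof.
move=> n0 cyc cS.
have fold m : (m <= n)%N -> exists2 d, supported (zero_below m) d & homologous (@cube_face n) c d.
  elim: m => [_|m IH mn]; first by exists c; [move=> s /cS | exact: homologous_refl].
  have [d dZ cd] := IH (ltnW mn).
  have [|e eZ de] := @fold_coordinate d (Ordinal mn) _ dZ.
    by rewrite -(homologous_bdry cd).
  by exists e => //; apply: homologous_trans cd de.
have [d dZ cd] := fold n (leqnn n); have cycd : bdry d = 0 by rewrite -(homologous_bdry cd).
apply: homologous_trans cd (cone_bounds_cycle (v := origin n) cycd _).
move=> s /dZ[_ s0]; exists (origin n), (Ordinal n0).
apply: subset_trans (ball_sub_cylinder _ _).
apply/subsetP => x; rewrite in_ball !inE => /predU1P[->|/s0 x0]; first by rewrite eqxx.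
by apply/orP; left; apply/eqP/ffunP => i; rewrite ffunE x0.
Qed.

Lemma cycle_bounds_card_le3 (c : chain vtx) : (0 < n)%N -> bdry c = 0 ->
  supported (fun s => cube_face s /\ #|s| <= 3)%N c -> homologous (@cube_face n) c 0.
Proof.
move=> n0 cyc cF; have [d dB cd] := cycle_to_bent_paths cyc cF.
have cycd : bdry d = 0 by rewrite -(homologous_bdry cd).
have [e eS de] := bent_paths_to_stars cycd dB.
have cyce : bdry e = 0 by rewrite -(homologous_bdry de).
exact: homologous_trans cd (homologous_trans de (star_cycle_bounds n0 cyce eS)).
Qed.

End LowDegrees.

(** * The Čech complex at scale 3 *)

Section DistanceBounds.
Variables (R : realType) (G : conn_graph).
Implicit Types (u v x : G) (p q : {ffun G -> R}) (t l : R).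

Local Notation vpt := (@vertex_point R G).
Local Notation ept := (@edge_point R G).

Definition affine_ext (h : G -> R) p : R := \sum_w p w * h w.

Lemma edge_point0 u v : ept u v 0 = vpt u.
Proof. by apply/ffunP => w; rewrite !ffunE subr0 mul1r mul0r addr0. Qed.

Lemma edge_point1 u v : ept u v 1 = vpt v.
Proof. by apply/ffunP => w; rewrite !ffunE subrr mul1r mul0r add0r. Qed.

Lemma edge_pointC u v t : ept u v t = ept v u (1 - t).
Proof. by apply/ffunP => w; rewrite !ffunE; ring. Qed.

Lemma affine_ext_vertex h u : affine_ext h (vpt u) = h u.
Proof.
rewrite /affine_ext (bigD1 u) //= ffunE eqxx mul1r big1 ?addr0 // => w /negPf wu.
by rewrite ffunE wu mul0r.
Qed.

Lemma affine_ext_edge h u v t : affine_ext h (ept u v t) = (1 - t) * h u + t * h v.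
Proof.
rewrite -!(affine_ext_vertex h) /affine_ext !mulr_sumr -big_split /=.
by apply: eq_bigr => w _; rewrite !ffunE; ring.
Qed.

Lemma affine_ext_route h p q l : (forall u v, adj u v -> `|h u - h v| <= 1) ->
  route p q l -> affine_ext h q <= affine_ext h p + l.
Proof.
move=> lip; elim=> [y|u v s t y l' uv _ _ _ IH]; first by rewrite addr0.
apply: le_trans IH _; rewrite !affine_ext_edge addrA lerD2r -lerBlDl.
apply: le_trans (ler_norm _) _.
have -> : (1 - t) * h u + t * h v - ((1 - s) * h u + s * h v) = (s - t) * (h u - h v) by ring.
by rewrite normrM ler_piMr // lip.
Qed.

Lemma route_ge0 p q l : route p q l -> 0 <= l.
Proof. by elim=> // *; apply: addr_ge0. Qed.

Lemma route_step x u p l : adj x u -> route (vpt u) p l -> route (vpt x) p (1 + l).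
Proof.
move=> xu r; rewrite -(edge_point0 x u) (_ : 1 = `|0 - 1|); last by rewrite sub0r normrN normr1.
by apply: (@route_cons R G x u 0 1); rewrite ?lexx ?ler01 // edge_point1.
Qed.

Lemma route_edge u v t : adj u v -> 0 <= t <= 1 -> route (vpt u) (ept u v t) (t + 0).
Proof.
move=> uv /andP[t0 t1]; rewrite -{1}(edge_point0 u v).
rewrite (_ : t + 0 = `|0 - t| + 0); last by rewrite sub0r normrN ger0_norm.
by apply: route_cons; rewrite ?lexx ?ler01 ?t0 //; apply: route_nil.
Qed.

Lemma route_connect x u p l : connect (@adj G) x u -> route (vpt u) p l ->
  exists l', route (vpt x) p l'.
Proof.
move=> /connectP[s + ->]; elim: s x l => /= [x l _ r|y s IH x l /andP[xy sP] r].
  by exists l.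
by have [l' r'] := IH y l sP r; exists (1 + l'); apply: route_step xy r'.
Qed.

Lemma route_from_vertex x p : realization p -> exists l, route (vpt x) p l.
Proof.
move=> [[v ->]|[u [v [t [uv t01 ->]]]]].
  exact: route_connect (adj_conn x v) (route_nil _).
exact: route_connect (adj_conn x u) (route_edge uv t01).
Qed.

Lemma lipschitz_le_path_dist h x p : (forall u v, adj u v -> `|h u - h v| <= 1) ->
  realization p -> affine_ext h p - h x <= path_dist (vpt x) p.
Proof.
move=> lip pG; apply: lb_le_inf => [|l /= /(affine_ext_route lip)]; first exact: route_from_vertex.
by rewrite affine_ext_vertex lerBlDl.
Qed.

Lemma path_dist_le_route p q l : route p q l -> path_dist p q <= l.
Proof. by move=> r; apply: ge_inf => //; exists 0 => l'; apply: route_ge0. Qed.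

Lemma path_dist_edge_point x u v t : adj x u -> adj u v -> 0 <= t <= 1 ->
  path_dist (vpt x) (ept u v t) <= 1 + t.
Proof.
move=> xu uv t01; rewrite -[t in leRHS]addr0.
exact: path_dist_le_route (route_step xu (route_edge uv t01)).
Qed.

End DistanceBounds.

Section CechCube.
Variables (R : realType) (n : nat).
Local Notation vtx := (hypercube_vertex n).
Local Notation G := (hypercube n).
Implicit Types (x u v : vtx) (p : {ffun G -> R}) (s : {set vtx}).

Lemma hdist_lipschitz x u v : hypercube_adj u v ->
  `|(hdist u x)%:R - (hdist v x)%:R| <= 1 :> R.
Proof.
move=> /adjP[k ->]; rewrite hdist_flip (hdistE u x k) !natrD opprD addrACA subrr addr0.
by case: eqP => _; rewrite ?subr0 ?sub0r ?normrN normr1.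
Qed.

Lemma affine_hdist_le x p (r : R) : closed_ball_at (vertex_point R (x : G)) r p ->
  affine_ext (fun u : G => (hdist u x)%:R) p <= r.
Proof.
move=> [pG]; apply: le_trans.
apply: le_trans (@lipschitz_le_path_dist R G _ x _ (hdist_lipschitz x) pG).
by rewrite hdistxx subr0.
Qed.

(* At a point of an edge [uv] within 3/2 of [x], one end is at distance at most 1
   from [x], as otherwise both ends would be at distance at least 2. *)
Lemma cech_cube_face s : (0 < n)%N ->
  s \in simplices (cech G (3 : R)) -> cube_face s.
Proof.
move=> n0; rewrite inE => /andP[/set0Pn[x0 x0s] /asboolP[p ps]].
have [+ _] := ps x0 x0s => -[[v pE]|[u [v [t [uv /andP[t0 t1] pE]]]]].
  exists v, (Ordinal n0); apply: subset_trans (ball_sub_cylinder _ _).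
  apply/subsetP => x xs; have := affine_hdist_le (ps x xs); rewrite pE affine_ext_vertex => vx.
  by rewrite inE leqNgt; apply/negP; rewrite -(ler_nat R); lra.
have /adjP[k vE] := uv; exists u, k; apply/subsetP => x xs.
have := affine_hdist_le (ps x xs); rewrite pE affine_ext_edge => px.
have [/(subsetP (ball_sub_cylinder u k))//|ux] := boolP (x \in ball u).
have [|vx] := boolP (x \in ball v).
  by rewrite -cylinder_flip -vE; apply: (subsetP (ball_sub_cylinder v k)).
by move: ux vx; rewrite !inE -!ltnNge -!(ler_nat R) => ux vx; nra.
Qed.

Lemma cube_face_cech s : s != set0 -> cube_face s -> s \in simplices (cech G (3 : R)).
Proof.
move=> s0 [u [k /subsetP su]]; rewrite inE s0; apply/asboolP.
have uv := adj_flip u k; have half01 : 0 <= (2^-1 : R) <= 1 by apply/andP; split; lra.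
have to_midpoint (x w w' : G) : adj x w -> adj w w' ->
    path_dist (vertex_point R x) (edge_point w w' 2^-1) <= 3 / 2.
  by move=> xw ww'; apply: le_trans (path_dist_edge_point xw ww' half01) _; lra.
exists (@edge_point R G u (flip u k) 2^-1) => x /su.
rewrite cylinderE !inE => ux; split; first by right; exists u, (flip u k), 2^-1.
case/orP: ux => [ux|vx]; first by apply: to_midpoint; rewrite //= adjC.
rewrite edge_pointC (_ : 1 - 2^-1 = 2^-1 :> R); last lra.
by apply: to_midpoint; rewrite //= adjC.
Qed.

End CechCube.

(** * Detecting homology classes modulo 2 *)

Section HomologyClasses.
Variables (V : finType) (K : simplicial_complex V) (i : int).

Lemma homology_neq0P : (exists h : reduced_homology K i, h != 0) <->
  exists2 c : chain V, c \in cycles K i &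
    ~ exists2 b, b \in chains K (i + 1) & bdry b = c.
Proof.
have pi_eq0 (z : cycle K i) :
    (\pi_(reduced_homology K i)%qT z == 0) = (z \in @boundaries V K i).
  by rewrite -[z in RHS]subr0 Quotient.idealrBE -pi_zeror.
split=> [[h]|[c cC cB]].
  rewrite -[h]reprK pi_eq0; case: (repr h) => c cC nb; exists c => // -[b bC bc].
  by case/negP: nb; apply/asboolP; exists b.
exists (\pi_(reduced_homology K i)%qT (Cycle cC)); rewrite pi_eq0.
by apply/negP => /asboolP.
Qed.

Lemma homology_eq0_lt : i < -1 -> ~ exists h : reduced_homology K i, h != 0.
Proof.
move=> i_lt /homology_neq0P[c /andP[/forallP cK _]]; apply; exists 0; first exact: rpred0.
rewrite raddf0; apply/esym/ffunP => s; rewrite [RHS]ffunE; apply/eqP.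
by apply: contraT => cs; have := cK s; rewrite cs => /andP[_ /eqP]; lia.
Qed.

End HomologyClasses.

Section Mod2Pairing.
Variable V : finType.
Implicit Types (s t : {set V}) (v w : V) (b c : chain V) (A : pred {set V}).

Definition mod2_pairing A c : 'F_2 := \sum_(s | A s) (c s)%:~R.

Definition facets_in A s : {set V} := [set v in s | A (s :\ v)].

Definition simplex_chain s : chain V := [ffun t => (t == s)%:R].

Lemma mod2_pairing_is_zmod_morphism A : zmod_morphism (mod2_pairing A).
Proof.
by move=> c d; rewrite -sumrB; apply: eq_bigr => s _; rewrite !ffunE intrB.
Qed.
HB.instance Definition _ A := GRing.isZmodMorphism.Build (chain V) 'F_2
  (mod2_pairing A) (mod2_pairing_is_zmod_morphism A).

Lemma facet_sign_mod2 s v (z : int) : (facet_sign s v * z)%:~R = z%:~R :> 'F_2.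
Proof.
rewrite /facet_sign -signr_odd; case: odd; rewrite ?mul1r // mulN1r rmorphN /=.
exact: (oppr_pchar2 (pchar_Fp _)).
Qed.

Lemma mod2_pairing_contract A v c :
  mod2_pairing A (contract v c) = \sum_(s : {set V} | (v \in s) && A (s :\ v)) (c s)%:~R.
Proof.
rewrite /mod2_pairing (bigID (fun s : {set V} => v \in s)) /= big1 ?add0r; last first.
  by move=> s /andP[_ vs]; rewrite ffunE vs.
rewrite (reindex_onto (fun s : {set V} => s :\ v) (fun t => v |: t)) /=; last first.
  by move=> s /andP[_ vs]; rewrite setU1K.
apply: eq_big => [s|s /andP[/andP[_ vs] /eqP sE]]; last first.
  by rewrite ffunE (negPf vs) facet_sign_mod2 sE.
rewrite !inE eqxx /= andbT andbC; have [vs|vs] := boolP (v \in s).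
  by rewrite setD1K ?eqxx.
by apply/negbTE; rewrite negb_and; apply/orP; left; apply: contraNneq vs => <-; rewrite setU11.
Qed.

Lemma mod2_pairing_bdry A c :
  mod2_pairing A (bdry c) = \sum_s (c s)%:~R * #|facets_in A s|%:R.
Proof.
rewrite bdryE raddf_sum /=; under eq_bigr do rewrite mod2_pairing_contract big_mkcond.
rewrite exchange_big; apply: eq_bigr => s _ /=.
by rewrite -big_mkcond mulr_natr -sumr_const; apply: eq_bigl => v; rewrite inE.
Qed.

Lemma mod2_pairing_bdry_simplex A s :
  mod2_pairing A (bdry (simplex_chain s)) = #|facets_in A s|%:R.
Proof.
rewrite mod2_pairing_bdry (bigD1 s) //= big1 ?addr0 => [|t /negPf ts].
  by rewrite ffunE eqxx mul1r.
by rewrite ffunE ts mul0r.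
Qed.

Lemma mod2_pairing_unique A c s : A s -> (forall t, c t != 0 -> A t -> t = s) ->
  mod2_pairing A c = (c s)%:~R.
Proof.
move=> As uniq_s; rewrite /mod2_pairing (bigD1 s) //= big1 ?addr0 // => t /andP[At /eqP ts].
by have [->|/uniq_s/(_ At)] := eqVneq (c t) 0.
Qed.

Lemma homology_neq0_pairing (K : simplicial_complex V) (i : int) A c :
  c \in cycles K i ->
  (forall s, is_simplex_of_dim K (i + 1) s -> ~~ odd #|facets_in A s|) ->
  mod2_pairing A c != 0 -> exists h : reduced_homology K i, h != 0.
Proof.
move=> cZ even cA; apply/homology_neq0P; exists c => // -[b /forallP bK bE].
case/eqP: cA; rewrite -bE mod2_pairing_bdry big1 // => s _.
have [->|/(implyP (bK s))/even] := eqVneq (b s) 0; first by rewrite mul0r.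
by rewrite -dvdn2 (dvdn_pcharf (pchar_Fp _)) // => /eqP ->; rewrite mulr0.
Qed.

Lemma even_card_unique_partner (X : {set V}) :
  {in X, forall v, exists w, X :\ v = [set w]} -> ~~ odd #|X|.
Proof.
move=> partner; have [->|[v vX]] := set_0Vmem X; first by rewrite cards0.
by have [w Xv] := partner v vX; rewrite (cardsD1 v) vX Xv cards1.
Qed.

End Mod2Pairing.

Section Rainbow.
Variables (V W : finType) (f : V -> W) (w0 : W).
Implicit Types (s t : {set V}) (v : V).

Definition omits s := f @: s == ~: [set w0].

Lemma omits_inj s : omits s -> #|s|.+1 = #|W| -> {in s &, injective f}.
Proof.
move=> /eqP fs sW; apply/imset_injP; rewrite fs -eqSS sW.
by rewrite cardsC1 prednK ?eqxx //; apply/card_gt0P; exists w0.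
Qed.

(* A set of #|W| vertices missing some colour has no facet with image W minus
   [w0], or two: the facets opposite to the vertices of the repeated colour. *)
Lemma even_omitting_facets s : #|s| = #|W| -> f @: s != setT -> ~~ odd #|facets_in omits s|.
Proof.
move=> sW fsT; apply: even_card_unique_partner => v; rewrite inE => /andP[vs omit_v].
have sDW u : u \in s -> #|s :\ u|.+1 = #|W| by move=> us; rewrite -sW (cardsD1 u s) us.
have inj_v := omits_inj omit_v (sDW v vs); have /eqP fsv := omit_v.
have fv : f v \in f @: (s :\ v).
  rewrite fsv !inE; apply: contra fsT => /eqP fvw; apply/eqP.
  by rewrite -(setD1K vs) imsetU1 fsv fvw setUCr.
have /imsetP[w wsv fvw] := fv; have /setD1P[wv ws] := wsv.
exists w; apply/setP => u; rewrite !inE; apply/idP/eqP => [/and3P[uv us omit_u]|->].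
  apply: contraNeq wv => uw; apply/eqP/(omits_inj omit_u (sDW u us)); rewrite // !inE.
    by rewrite eq_sym uw.
  by rewrite eq_sym uv.
rewrite wv ws /omits /= -fsv eqEsubset.
apply/andP; split; apply/subsetP => _ /imsetP[x /setD1P[xw xs] ->].
  have [->//|xv] := eqVneq x v; by apply: imset_f; rewrite !inE xv.
have [->|xw'] := eqVneq x w; last by apply: imset_f; rewrite !inE xw'.
by rewrite -fvw; apply: imset_f; rewrite !inE eq_sym wv.
Qed.

Lemma card_omitting_facets s : #|s| = #|W| -> f @: s = setT -> #|facets_in omits s| = 1%N.
Proof.
move=> sW fsT; have inj_f : {in s &, injective f} by apply/imset_injP; rewrite fsT cardsT sW.
have /imsetP[v vs w0E] : w0 \in f @: s by rewrite fsT.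
have -> : facets_in omits s = [set v]; last by rewrite cards1.
have fsD u : u \in s -> f @: (s :\ u) = ~: [set f u].
  move=> us; rewrite -setTD -fsT; apply/setP => z; rewrite !inE.
  apply/imsetP/andP => [[x /setD1P[xu xs] ->]|[zu /imsetP[x xs zE]]].
    by rewrite imset_f // (inj_in_eq inj_f).
  by exists x => //; rewrite !inE xs andbT; apply: contra_neq zu => <-.
apply/setP => u; rewrite !inE; apply/andP/eqP => [[us]|->].
  rewrite /omits /= fsD // (inj_eq (@setC_inj _)) => /eqP/set1_inj.
  by rewrite w0E => /inj_f; apply.
by rewrite /omits /= fsD // w0E.
Qed.

End Rainbow.

Section CrossPolytope.
Variables (V : finType) (pole : nat -> bool -> V).
Implicit Types (s : {set V}) (sigma : nat -> bool) (d : nat).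

Fixpoint cross_cycle d : chain V :=
  if d is d'.+1 then cone (pole d' false) (cross_cycle d') - cone (pole d' true) (cross_cycle d')
  else simplex_chain set0.

Fixpoint cross_facet sigma d : {set V} :=
  if d is d'.+1 then pole d' (sigma d') |: cross_facet sigma d' else set0.

Definition distinct_poles d := forall i j b b', (i < d)%N -> (j < d)%N ->
  pole i b = pole j b' -> i = j /\ b = b'.

Lemma in_cross_facet sigma d x :
  x \in cross_facet sigma d -> exists2 i, (i < d)%N & x = pole i (sigma i).
Proof.
elim: d => [|d IH] /=; rewrite ?inE //.
by move=> /predU1P[->|/IH[i id ->]]; [exists d | exists i => //; apply: ltnW].
Qed.

Lemma mem_cross_facet sigma d (i : 'I_d) : pole i (sigma i) \in cross_facet sigma d.
Proof.
case: i => i; elim: d => //= d IH; rewrite ltnS leq_eqVlt !inE => /predU1P[->|/IH ->].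
  by rewrite eqxx.
by rewrite orbT.
Qed.

Lemma distinct_polesS d : distinct_poles d.+1 -> distinct_poles d.
Proof. by move=> dp i j b b' id jd; apply: dp; rewrite ltnW. Qed.

Lemma pole_notin_cross_facet sigma d b : distinct_poles d.+1 ->
  pole d b \notin cross_facet sigma d.
Proof.
move=> dp; apply/negP => /in_cross_facet[i id /dp[||di _]] //; first exact: ltnW.
by rewrite di ltnn in id.
Qed.

Lemma card_cross_facet sigma d : distinct_poles d -> #|cross_facet sigma d| = d.
Proof.
elim: d => [|d IH] dp /=; first by rewrite cards0.
by rewrite cardsU1 pole_notin_cross_facet // IH //; apply: distinct_polesS.
Qed.

Lemma eq_cross_facet sigma tau d : (forall i, (i < d)%N -> sigma i = tau i) ->
  cross_facet sigma d = cross_facet tau d.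
Proof.
by elim: d => //= d IH st; rewrite st // IH // => i id; rewrite st // leqW.
Qed.

Lemma bdry_cross_cycle d : bdry (cross_cycle d) = 0.
Proof.
elim: d => [|d IH] /=; last by rewrite raddfB /= !bdry_cone IH !raddf0 subrr.
apply/ffunP => t; rewrite [RHS]ffunE; apply/eqP; apply: contraT => /bdry_supp[s /card_facet].
by rewrite ffunE; case: (eqVneq s set0) => [->|]; rewrite ?cards0 ?eqxx.
Qed.

Lemma cross_cycle_supp d s : cross_cycle d s != 0 -> exists sigma, s = cross_facet sigma d.
Proof.
elim: d s => [|d IH] s /=.
  by rewrite ffunE; case: (eqVneq s set0) => [-> _|]; rewrite ?eqxx //; exists xpredT.
have cone_case b : cone (pole d b) (cross_cycle d) s != 0 ->
    exists sigma, s = cross_facet sigma d.+1.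
  move=> /cone_supp[ps /IH[sigma sE]]; exists (fun i => if i == d then b else sigma i).
  rewrite /= eqxx -(setD1K ps) sE; congr (_ |: _).
  by apply: eq_cross_facet => i id; rewrite (ltn_eqF id).
rewrite chainBE; have [->|/cone_case//] := eqVneq (cone (pole d false) (cross_cycle d) s) 0.
by rewrite sub0r oppr_eq0 => /cone_case.
Qed.

Lemma cross_cycle_facet sigma d : distinct_poles d ->
  (cross_cycle d (cross_facet sigma d))%:~R = 1 :> 'F_2.
Proof.
elim: d => [|d IH] dp /=; first by rewrite ffunE eqxx.
have notin b := pole_notin_cross_facet sigma b dp.
have other_pole b : b != sigma d ->
    cone (pole d b) (cross_cycle d) (pole d (sigma d) |: cross_facet sigma d) = 0.
  move=> bs; rewrite ffunE ifN // !inE negb_or notin andbT.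
  by apply: contra bs => /eqP/dp[||_ ->].
have sigma_pole :
    (cone (pole d (sigma d)) (cross_cycle d) (pole d (sigma d) |: cross_facet sigma d))%:~R
      = 1 :> 'F_2.
  by rewrite ffunE setU11 facet_sign_mod2 setU1K // IH //; apply: distinct_polesS.
rewrite chainBE; case: (sigma d) sigma_pole other_pole => sigma_pole other_pole.
  by rewrite other_pole // sub0r rmorphN /= sigma_pole (oppr_pchar2 (pchar_Fp _)).
by rewrite (other_pole true) // subr0.
Qed.

Lemma sum_cross_facet (M : nmodType) (g : V -> M) sigma d : distinct_poles d ->
  \sum_(x in cross_facet sigma d) g x = \sum_(i < d) g (pole i (sigma i)).
Proof.
elim: d => [|d IH] dp; first by rewrite big_set0 big_ord0.
rewrite big_setU1 ?pole_notin_cross_facet //= IH ?big_ord_recr 1?addrC //.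
exact: distinct_polesS.
Qed.

End CrossPolytope.

Section Winding.
Variables (V : finType) (F : realFieldType) (E : vectType F) (phi : V -> E) (y : E).
Implicit Types (s t : {set V}) (u v w : V) (lam kap mu : V -> F).

Definition combine lam s : E := \sum_(x in s) lam x *: phi x.

Definition in_cone s : Prop := exists2 lam, {in s, forall x, 0 <= lam x} & combine lam s = y.

Definition generic_target := forall t lam, (#|t| < \dim {: E})%N -> combine lam t <> y.

Lemma combineD lam mu s : combine (fun x => lam x + mu x) s = combine lam s + combine mu s.
Proof. by rewrite -big_split; apply: eq_bigr => x _; rewrite scalerDl. Qed.

Lemma combineZ c lam s : combine (fun x => c * lam x) s = c *: combine lam s.
Proof. by rewrite scaler_sumr; apply: eq_bigr => x _; rewrite scalerA. Qed.

Lemma combineD1 lam s v : lam v = 0 -> combine lam (s :\ v) = combine lam s.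
Proof.
move=> lv; rewrite /combine; have [vs|vs] := boolP (v \in s).
  by rewrite [RHS](big_setD1 v) //= lv scale0r add0r.
by apply: eq_bigl => x; rewrite !inE; case: (eqVneq x v) vs => // -> /negPf.
Qed.

Lemma in_coneD1P s v : v \in s ->
  in_cone (s :\ v) <-> exists lam, [/\ {in s, forall x, 0 <= lam x}, lam v = 0 & combine lam s = y].
Proof.
move=> vs; split=> [[lam lam0 lamy]|[lam [lam0 lv lamy]]]; last first.
  by exists lam; [move=> x /setD1P[_ /lam0] | rewrite combineD1].
exists (fun x => if x == v then 0 else lam x); split; rewrite ?eqxx //.
  by move=> x xs; case: ifPn => // xv; apply: lam0; rewrite !inE xv.
rewrite -(@combineD1 _ _ v) ?eqxx // -lamy; apply: eq_bigr => x /setD1P[/negPf-> _] //.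
Qed.

Lemma exists_dependency s : (\dim {: E} < #|s|)%N ->
  exists2 kap, exists2 x, x \in s & kap x != 0 & combine kap s = 0.
Proof.
move=> dim_s; pose X := [tuple phi (enum_val i) | i < #|s|].
have : ~~ free X.
  by rewrite /free neq_ltn size_tuple (leq_ltn_trans (dimvS (subvf _)) dim_s).
have [x0 x0s] : exists x, x \in s by apply/card_gt0P; apply: leq_ltn_trans dim_s.
move=> /freeP nfree; apply: contrapT => nodep; apply: nfree => k k0 i.
apply/eqP; apply: contraT => ki; case: nodep; exists (fun x => k (enum_rank_in x0s x)).
  by exists (enum_val i); [exact: enum_valP | rewrite enum_valK_in].
rewrite -[RHS]k0 /combine big_enum_val; apply: eq_bigr => j _.
by rewrite enum_valK_in (nth_mktuple (fun i => phi (enum_val i))).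
Qed.

Section Pivot.
Variables (s : {set V}) (ell : {scalar E}).
Hypothesis card_s : #|s| = (\dim {: E}).+1.
Hypothesis generic_y : generic_target.
Hypothesis ell_gt0 : {in s, forall x, 0 < ell (phi x)}.

Lemma zero_weight_unique lam u w : combine lam s = y ->
  u \in s -> w \in s -> lam u = 0 -> lam w = 0 -> u = w.
Proof.
move=> lamy us ws lu lw; apply/eqP; apply: contraT => uw.
case: (@generic_y (s :\ u :\ w) lam); last by rewrite !combineD1.
by move: card_s; rewrite (cardsD1 u) us (cardsD1 w) !inE eq_sym uw ws; lia.
Qed.

Lemma dependency_eq0 lam kap v : v \in s -> combine lam s = y -> lam v = 0 ->
  combine kap s = 0 -> kap v = 0 -> {in s, forall x, kap x = 0}.
Proof.
move=> vs lamy lv kap0 kv u us; apply/eqP; apply: contraT => ku.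
have vu : v = u.
  apply: (@zero_weight_unique (fun x => lam x + - (lam u / kap u) * kap x)) => //.
  - by rewrite combineD combineZ kap0 scaler0 addr0.
  - by rewrite lv kv mulr0 addr0.
  - by rewrite mulNr divfK // subrr.
by rewrite -vu kv eqxx in ku.
Qed.

Lemma dependency_sign kap v : v \in s -> 0 < kap v -> combine kap s = 0 ->
  exists2 w, w \in s & kap w < 0.
Proof.
move=> vs kv kap0; apply: contrapT => nneg.
have kap_ge0 x : x \in s -> 0 <= kap x.
  by move=> xs; rewrite leNgt; apply/negP => kx; case: nneg; exists x.
have : 0 < ell (combine kap s).
  rewrite raddf_sum /= (bigD1 v) //= ltr_wpDr //; last by rewrite linearZ mulr_gt0 ?ell_gt0.
  by apply: sumr_ge0 => x /andP[xs _]; rewrite linearZ mulr_ge0 ?kap_ge0 // ltW ?ell_gt0.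
by rewrite kap0 raddf0 ltxx.
Qed.

Lemma normalized_dependency lam v : v \in s -> combine lam s = y -> lam v = 0 ->
  exists2 kap, kap v = 1 & combine kap s = 0.
Proof.
move=> vs lamy lv; have [|kap [x xs kx] kap0] := @exists_dependency s; first by rewrite card_s.
have kv : kap v != 0.
  by apply: contra kx => /eqP kv; rewrite (dependency_eq0 vs lamy lv kap0 kv).
by exists (fun x => (kap v)^-1 * kap x); rewrite ?mulVf // combineZ kap0 scaler0.
Qed.

Lemma representation_line lam kap mu v : v \in s ->
  combine lam s = y -> lam v = 0 -> kap v = 1 -> combine kap s = 0 -> combine mu s = y ->
  {in s, forall x, mu x = lam x + mu v * kap x}.
Proof.
move=> vs lamy lv kv kap0 muy x xs; apply/eqP; rewrite -subr_eq0 -mulN1r; apply/eqP.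
apply: (@dependency_eq0 lam (fun x => mu x + -1 * (lam x + mu v * kap x)) v) => //.
  by rewrite combineD combineZ combineD combineZ kap0 scaler0 addr0 muy lamy scaleN1r subrr.
by rewrite lv kv; ring.
Qed.

(* The representations of [y] by nonnegative weights on [s] form a segment in the
   direction of the dependency [kap]. One end is [lam]; the other one is reached
   where the first weight other than that of [v] vanishes. *)
Lemma cone_pivot v : v \in s -> in_cone (s :\ v) -> exists w, forall u,
  (u \in s :\ v /\ in_cone (s :\ u)) <-> u = w.
Proof.
move=> vs /(in_coneD1P vs)[lam [lam_ge0 lv lamy]].
have lam_gt0 x : x \in s -> x != v -> 0 < lam x.
  move=> xs xv; rewrite lt_def lam_ge0 // andbT; apply: contra xv => /eqP lx.
  by rewrite (zero_weight_unique lamy xs vs lx lv).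
have [kap kv kap0] := normalized_dependency vs lamy lv.
have [|w0 w0s kw0] := dependency_sign vs _ kap0; first by rewrite kv.
pose exit_time x := lam x / - kap x.
have [|w /andP[ws kw] exit_w_min] :=
  @arg_minP _ _ _ w0 (fun x => (x \in s) && (kap x < 0)) exit_time; first by rewrite w0s.
set t := exit_time w in exit_w_min.
have wv : w != v by apply: contraTneq kw => ->; rewrite kv ltr10.
have t_ge0 : 0 <= t by rewrite divr_ge0 ?lam_ge0 // oppr_ge0 ltW.
have exit_w : lam w + t * kap w = 0 by rewrite /t /exit_time invrN mulrN mulNr divfK ?subrr ?lt_eqF.
exists w => u; split=> [[/setD1P[uv us] /(in_coneD1P us)[mu [mu_ge0 mu_u muy]]]|->]; last first.
  split; first by rewrite !inE wv.
  apply/(in_coneD1P ws); exists (fun x => lam x + t * kap x); split=> //; last first.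
    by rewrite combineD combineZ kap0 scaler0 addr0.
  move=> x xs; have [kx|kx] := ltP (kap x) 0; last first.
    by apply: addr_ge0; [exact: lam_ge0 | exact: mulr_ge0].
  have := exit_w_min x; rewrite xs kx => /(_ isT).
  by rewrite [leRHS]/exit_time ler_pdivlMr ?oppr_gt0 // mulrN -sub0r lerBlDr.
have muE := representation_line vs lamy lv kv kap0 muy.
have mu_v_ge0 := mu_ge0 v vs.
have ku : kap u < 0.
  have := lam_gt0 u us uv; rewrite ltNge => lam_u; apply: contraTT lam_u => ku.
  have := muE u us; rewrite mu_u => /esym/eqP; rewrite addr_eq0 => /eqP ->.
  by rewrite negbK oppr_le0 mulr_ge0 // leNgt.
have exit_u : mu v = exit_time u.
  apply: (mulIf (lt0r_neq0 (_ : 0 < - kap u))); rewrite ?oppr_gt0 //.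
  rewrite divfK ?oppr_eq0 ?lt_eqF // mulrN; apply/eqP.
  by rewrite eq_sym -subr_eq0 opprK -muE // mu_u.
have exit_le : mu v <= t.
  by rewrite /t /exit_time ler_pdivlMr ?oppr_gt0 // mulrN -subr_ge0 opprK -muE ?mu_ge0.
have mu_t : mu v = t.
  by apply/eqP; rewrite eq_le exit_le exit_u exit_w_min // us ku.
by apply: (zero_weight_unique muy) => //; rewrite muE // mu_t.
Qed.

Lemma even_cone_facets : ~~ odd #|facets_in (fun r => `[< in_cone r >]) s|.
Proof.
apply: even_card_unique_partner => v; rewrite inE => /andP[vs /asboolP/(cone_pivot vs)[w wP]].
exists w; apply/setP => u; rewrite !inE.
apply/and3P/eqP => [[uv us /asboolP uc]|/wP[/setD1P[uv us] uc]].
  by apply/wP; rewrite !inE uv us.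
by split=> //; apply/asboolP.
Qed.

End Pivot.

Lemma in_cone_cross_facetP (pole : nat -> bool -> V) sigma d : distinct_poles pole d ->
  in_cone (cross_facet pole sigma d) <->
  exists2 l : nat -> F, (forall i, (i < d)%N -> 0 <= l i) &
    \sum_(i < d) l i *: phi (pole i (sigma i)) = y.
Proof.
move=> dp; split=> [[lam lam_ge0 lamy]|[l l_ge0 ly]].
  exists (fun i => lam (pole i (sigma i))); last by rewrite -lamy /combine sum_cross_facet.
  by move=> i id; apply: lam_ge0; apply: (mem_cross_facet _ _ (Ordinal id)).
exists (fun x => \sum_(i < d | x == pole i (sigma i)) l i).
  by move=> x _; apply: sumr_ge0 => i _; apply: l_ge0.
rewrite -ly /combine sum_cross_facet //; apply: eq_bigr => i _; congr (_ *: _).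
apply: big_pred1 => j /=; apply/eqP/eqP => [/dp[] // ij _|->//].
by apply/val_inj.
Qed.

End Winding.

(** * The classes in degrees 4 and 3 *)

Section CubeChains.
Variables (R : realType) (n : nat).
Hypothesis n0 : (0 < n)%N.
Local Notation K := (cech (hypercube n) (3 : R)).
Implicit Types (s : {set hypercube_vertex n}) (c : chain (hypercube_vertex n)).

Lemma is_simplex_of_dim_cubeP (m : nat) s :
  reflect (cube_face s /\ #|s| = m) (is_simplex_of_dim K (m%:Z - 1) s).
Proof.
rewrite /is_simplex_of_dim subrK; apply: (iffP andP) => [[sK /eqP[sm]]|[sF ->]]; split=> //.
  have [s0|s0] := eqVneq s set0; last by apply: (@cech_cube_face R) => //; rewrite (negPf s0) in sK.
  by exists (origin n), (Ordinal n0); rewrite s0 sub0set.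
by have [//|s0] := eqVneq s set0; apply: cube_face_cech.
Qed.

Lemma chains_cubeP (m : nat) c :
  reflect (supported (fun s => cube_face s /\ #|s| = m) c) (c \in chains K (m%:Z - 1)).
Proof.
rewrite inE; apply: (iffP forallP) => cK s.
  by move=> cs; apply/is_simplex_of_dim_cubeP; apply: (implyP (cK s)).
by apply/implyP => /cK/is_simplex_of_dim_cubeP.
Qed.

Lemma predz_add1 (m : nat) : m%:Z - 1 + 1 = m.+1%:Z - 1.
Proof. by lia. Qed.

Lemma cube_homology_eq0 (m : nat) :
  ((m <= 3) || (6 <= m))%N -> ~ exists h : reduced_homology K (m%:Z - 1), h != 0.
Proof.
move=> m36 /homology_neq0P[c /andP[/chains_cubeP cK /eqP c0]]; apply.
have cF : homologous (@cube_face n) c 0.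
  case/orP: m36 => hm; [apply: cycle_bounds_card_le3 | apply: cycle_bounds_card_ge6] => //;
    by apply: supportedW cK => s [sF ->].
have [|b bK bE] := @homologous0_card _ _ c m _ cF; first by apply: supportedW cK => s [_].
by exists b => //; rewrite predz_add1; apply/chains_cubeP.
Qed.

Lemma cube_homology_neq0 (m : nat) (A : pred {set hypercube_vertex n}) c : bdry c = 0 ->
  supported (fun s => cube_face s /\ #|s| = m) c ->
  (forall s, cube_face s -> #|s| = m.+1 -> ~~ odd #|facets_in A s|) ->
  mod2_pairing A c != 0 -> exists h : reduced_homology K (m%:Z - 1), h != 0.
Proof.
move=> cyc cF even; apply: homology_neq0_pairing.
  by apply/andP; split; [apply/chains_cubeP | apply/eqP].
by move=> s; rewrite predz_add1 => /is_simplex_of_dim_cubeP[]; apply: even.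
Qed.

End CubeChains.

Section SmallCubes.
Variable n : nat.
Local Notation vtx := (hypercube_vertex n).
Implicit Types (a x : vtx) (s : {set vtx}) (i j k : 'I_n) (g h : nat -> bool) (m : nat).

Definition embed m g : vtx := [ffun i : 'I_n => (i < m)%N && g i].

Lemma embed_cylinder m g h k :
  (count (fun j : nat => (j != k) && (g j != h j)) (iota 0 m) <= 1)%N ->
  embed m h \in cylinder (embed m g) k.
Proof.
move=> le1; rewrite inE; apply: leq_trans le1; rewrite -size_filter -(size_image val).
apply: uniq_leq_size; first by rewrite map_inj_uniq ?enum_uniq //; apply: val_inj.
move=> _ /mapP[j + ->]; rewrite mem_enum !inE mem_filter mem_iota !ffunE -val_eqE /=.
by case: ltnP => [_ /andP[-> ->]|_]; rewrite ?andbF.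
Qed.

Lemma embed_inj m g h : (m <= n)%N -> embed m g = embed m h ->
  forall j : nat, (j < m)%N -> g j = h j.
Proof.
by move=> mn /ffunP gh j jm; have := gh (Ordinal (leq_trans jm mn)); rewrite !ffunE /= jm.
Qed.

Lemma cylinder_not_opposite a k x i j : x \in cylinder a k ->
  i != j -> i != k -> j != k -> x i = ~~ a i -> x j <> ~~ a j.
Proof.
rewrite inE => /card_le1_eqP xa ij ik jk xi xj; case/eqP: ij.
by apply: xa; rewrite !inE ?ik ?jk ?xi ?xj; case: (a _).
Qed.

End SmallCubes.

Section DegreeFour.
Variable n : nat.
Hypothesis n3 : (3 <= n)%N.
Local Notation vtx := (hypercube_vertex n).
Implicit Types (a x : vtx) (s : {set vtx}) (w : bool * option bool).

Let axis0 : 'I_n := Ordinal (leq_trans (isT : 0 < 3)%N n3).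
Let axis1 : 'I_n := Ordinal (leq_trans (isT : 1 < 3)%N n3).
Let axis2 : 'I_n := Ordinal (leq_trans (isT : 2 < 3)%N n3).

Definition colour x : bool * option bool :=
  (x axis1, if x axis1 == x axis2 then None else Some (x axis0)).

Definition colour_bits w (j : nat) : bool :=
  nth false [:: odflt (~~ w.1) w.2; w.1; (w.2 != None) (+) w.1] j.

(* The vertices of the 3-cube other than the antipodal pair 000, 111. *)
Definition sphere_vertices : {set vtx} := [set embed n 3 (colour_bits w) | w in setT].

Lemma colour_embed w : colour (embed n 3 (colour_bits w)) = w.
Proof.
by rewrite /colour !ffunE /=; case: w => [[] [[]|]].
Qed.

Lemma colour_sphere : colour @: sphere_vertices = setT.
Proof.
by apply/setP => w; rewrite inE -[w]colour_embed imset_f // imset_f.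
Qed.

Lemma card_sphere_vertices : #|sphere_vertices| = #|{: bool * option bool}|.
Proof. by rewrite card_imset ?cardsT //; apply: can_inj colour_embed. Qed.

Lemma sphere_facet_face x : x \in sphere_vertices -> cube_face (sphere_vertices :\ x).
Proof.
move=> /imsetP[w _ ->].
pose minority := if w.2 is Some b then (if b == w.1 then axis2 else axis1) else axis0.
pose majority := odflt w.1 w.2.
exists (embed n 3 (fun=> ~~ majority)), minority.
apply/subsetP => z /setD1P[/eqP zw /imsetP[w' _ zE]].
have {zw} ww' : w' <> w by move=> ww'; rewrite zE ww' in zw.
rewrite zE; apply: embed_cylinder; rewrite /minority /majority.
by case: w w' {zE minority majority} ww' => [[] [[]|]] [[] [[]|]].
Qed.

Lemma colour_Some x b b0 : colour x = (b, Some b0) ->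
  [/\ x axis0 = b0, x axis1 = b & x axis2 = ~~ b].
Proof.
rewrite /colour; case: eqVneq => // x12 [<- <-]; split=> //.
by case: (x _) (x _) x12 => [] [].
Qed.

Lemma colour_None x b : colour x = (b, None) -> x axis1 = b /\ x axis2 = b.
Proof. by rewrite /colour; case: eqP => // <- [<-]. Qed.

(* Two of the three axes differ from the direction [k] of the cylinder, and some
   colour requires the values opposite to [a] on both of them. *)
Lemma face_not_rainbow s : cube_face s -> colour @: s != setT.
Proof.
move=> [a [k sa]]; apply/negP => /eqP rainbow.
have coloured w : exists2 x, x \in cylinder a k & colour x = w.
  have : w \in colour @: s by rewrite rainbow.
  by move=> /imsetP[x xs ->]; exists x => //; apply: (subsetP sa).
have [k1|k1] := eqVneq axis1 k.
  have [x xa /colour_Some[x0 _ x2]] := coloured (a axis2, Some (~~ a axis0)).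
  by apply: (@cylinder_not_opposite _ a k x axis0 axis2 xa); rewrite -?k1.
have [k2|k2] := eqVneq axis2 k.
  have [x xa /colour_Some[x0 x1 _]] := coloured (~~ a axis1, Some (~~ a axis0)).
  by apply: (@cylinder_not_opposite _ a k x axis0 axis1 xa); rewrite -?k2.
have [a12|a12] := eqVneq (a axis1) (a axis2).
  have [x xa /colour_None[x1 x2]] := coloured (~~ a axis1, None).
  by apply: (@cylinder_not_opposite _ a k x axis1 axis2 xa); rewrite // x2 a12.
have [x xa /colour_Some[_ x1 x2]] := coloured (~~ a axis1, Some true).
apply: (@cylinder_not_opposite _ a k x axis1 axis2 xa); rewrite // x2.
by case: (a _) (a _) a12 => [] [].
Qed.

Lemma cube_homology4_neq0 (R : realType) :
  exists h : reduced_homology (cech (hypercube n) (3 : R)) 4, h != 0.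
Proof.
have n0 : (0 < n)%N by apply: leq_trans n3.
have card_sphere : #|sphere_vertices| = 6%N.
  by rewrite card_sphere_vertices card_prod card_option !card_bool.
apply: (@cube_homology_neq0 R n n0 5 (omits colour (true, None))
          (bdry (simplex_chain sphere_vertices))).
- exact: bdry_bdry.
- move=> t /bdry_supp[s ts]; rewrite ffunE.
  case: (eqVneq s sphere_vertices) ts => [-> ts _|]; last by rewrite eqxx.
  have := card_facet ts; rewrite card_sphere => -[<-]; split=> //.
  by have [x xT ->] := facetP ts; apply: sphere_facet_face.
- move=> s /face_not_rainbow + s6; apply: even_omitting_facets.
  by rewrite s6 -card_sphere card_sphere_vertices.
by rewrite mod2_pairing_bdry_simplex card_omitting_facets ?colour_sphere // card_sphere_vertices.
Qed.

End DegreeFour.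

(* After absorbing the signs of the first equation into the weights, there are
   eight sign patterns for each of the others, and no three of them are compatible. *)
Lemma three_signs_not_powers (la lb lc : rat) (a b c : 'I_4 -> bool) :
  ~ (forall i, la * (-1) ^+ a i + lb * (-1) ^+ b i + lc * (-1) ^+ c i = 2 ^+ i).
Proof.
move=> eq_pow.
have absorb (l : rat) (e f : bool) : l * (-1) ^+ f = l * (-1) ^+ e * (-1) ^+ (e (+) f).
  by rewrite -mulrA -signr_addb addKb.
have {absorb} eq_pow i : la * (-1) ^+ a ord0 * (-1) ^+ (a ord0 (+) a i) +
    lb * (-1) ^+ b ord0 * (-1) ^+ (b ord0 (+) b i) +
    lc * (-1) ^+ c ord0 * (-1) ^+ (c ord0 (+) c i) = 2 ^+ i.
  by rewrite -!absorb.
move: (la * _) (lb * _) (lc * _) eq_pow => wa wb wc eq_pow.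
have := (eq_pow ord0, eq_pow (inord 1), eq_pow (inord 2), eq_pow (inord 3)).
rewrite !inordK // !addbb /= !expr0 !mulr1 => -[[[]]].
case: (_ (+) _) (_ (+) _) (_ (+) _) => [] [] [] e0 e1; try lra;
  case: (_ (+) _) (_ (+) _) (_ (+) _) => [] [] [] e2; try lra;
  case: (_ (+) _) (_ (+) _) (_ (+) _) => [] [] [] e3; lra.
Qed.

Section DegreeThree.
Variable n : nat.
Hypothesis n4 : (4 <= n)%N.
Local Notation vtx := (hypercube_vertex n).
Implicit Types (a x : vtx) (s t : {set vtx}) (k : 'I_n) (sigma : nat -> bool).

Definition sign_vector x : 'rV[rat]_4 := \row_(i < 4) (-1) ^+ x (widen_ord n4 i).

Definition target : 'rV[rat]_4 := \row_(i < 4) 2 ^+ i.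

Definition off_axis_sum a k (z : 'rV[rat]_4) : rat :=
  \sum_(i < 4 | widen_ord n4 i != k) (-1) ^+ a (widen_ord n4 i) * z 0 i.

(* The eight poles [pole i b] form the cycle of a geodesic from 0000 to 1111 and its
   antipode; the sign vectors of [pole i false] and [pole i true] are opposite. *)
Definition pole (i : nat) (b : bool) : vtx := embed n 4 (fun j => (j < i)%N (+) b).

Fact off_axis_sum_is_scalar a k : scalar (off_axis_sum a k).
Proof.
move=> c z z'; rewrite /off_axis_sum mulr_sumr -big_split /=.
by apply: eq_bigr => i _; rewrite !mxE; ring.
Qed.
HB.instance Definition _ a k := GRing.isLinear.Build rat 'rV[rat]_4 rat *%R
  (off_axis_sum a k) (off_axis_sum_is_scalar a k).

Lemma off_axis_sum_gt0 a k x : x \in cylinder a k -> 0 < off_axis_sum a k (sign_vector x).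
Proof.
rewrite inE => xa; set w := widen_ord n4.
have w_inj : injective w by move=> i j /(congr1 val) /= /val_inj.
pose off := [set i | w i != k]; pose wrong := [set i in off | a (w i) != x (w i)].
have off_ge3 : (3 <= #|off|)%N.
  have : (#|~: off| <= 1)%N.
    by apply/card_le1_eqP => i j; rewrite !inE !negbK => /eqP ik /eqP jk; apply: w_inj; rewrite ik.
  by have := cardsC off; rewrite card_ord; lia.
have wrong_le1 : (#|wrong| <= 1)%N.
  apply: leq_trans xa; rewrite -(card_imset _ w_inj).
  by apply/subset_leq_card/subsetP => _ /imsetP[i + ->]; rewrite !inE.
suff -> : off_axis_sum a k (sign_vector x) = #|off|%:R - 2 * #|wrong|%:R.
  by move: off_ge3 wrong_le1; rewrite -!(ler_nat rat); lra.
transitivity (\sum_(i in off) (1 - 2 * (a (w i) != x (w i))%:R) : rat).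
  apply: eq_big => i; first by rewrite inE.
  by rewrite mxE -/w; case: (a (w i)); case: (x (w i)) => _; rewrite /= ?expr0 ?expr1; ring.
rewrite sumrB sumr_const -mulr_sumr -natr_sum; congr (_ - 2 * _%:R).
by rewrite -sum1dep_card big_mkcondr /=; apply: eq_bigr => i _; case: eqP.
Qed.

Lemma distinct_poles_pole : distinct_poles pole 4.
Proof.
move=> i j b b' i4 j4 /(embed_inj n4) eq_bits.
have := (eq_bits 0%N isT, eq_bits 1%N isT, eq_bits 2%N isT, eq_bits 3%N isT).
by move: i j i4 j4 b b' {eq_bits} => [|[|[|[|i]]]] [|[|[|[|j]]]] //= _ _ [] [] [[[]]].
Qed.

(* The cylinder has direction [k], and its axis has the bits of [sigma] with bit [l]
   changed; no bit is changed if [l = 4]. *)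
Lemma cross_facet_witness sigma :
  has (fun k : nat => has (fun l : nat => all (fun i : nat =>
    count (fun j : nat => (j != k) && ((sigma j (+) (j == l)) != ((j < i)%N (+) sigma i)))
      (iota 0 4) <= 1)%N (iota 0 4)) (iota 0 5)) (iota 0 4).
Proof.
by move=> /=; case: (sigma 0%N); case: (sigma 1%N); case: (sigma 2%N); case: (sigma 3%N).
Qed.

Lemma cross_facet_face sigma : cube_face (cross_facet pole sigma 4).
Proof.
have /hasP[k + /hasP[l _ /allP few]] := cross_facet_witness sigma.
rewrite mem_iota => /andP[_ k4]; pose axis : 'I_n := Ordinal (leq_trans k4 n4).
exists (embed n 4 (fun j => sigma j (+) (j == l))), axis.
apply/subsetP => _ /in_cross_facet[i i4 ->]; apply: embed_cylinder.
by apply: few; rewrite mem_iota.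
Qed.

Lemma generic_target_vector : generic_target sign_vector target.
Proof.
move=> t lam; rewrite dimvf dim_matrix mul1r cardE /combine -big_enum /= => t3 eq_target.
have coord i : \sum_(x <- enum t) lam x * (-1) ^+ x (widen_ord n4 i) = 2 ^+ i.
  move/rowP/(_ i): eq_target; rewrite summxE !mxE => <-.
  by apply: eq_bigr => x _; rewrite !mxE.
pose bit (x : vtx) i := x (widen_ord n4 i).
move: (enum t) t3 coord => [|x1 [|x2 [|x3 [|]]]] //= _ coord.
- apply: (@three_signs_not_powers 0 0 0 xpredT xpredT xpredT) => i.
  by rewrite -coord big_nil; ring.
- apply: (@three_signs_not_powers (lam x1) 0 0 (bit x1) xpredT xpredT) => i.
  by rewrite -coord big_seq1; ring.
- apply: (@three_signs_not_powers (lam x1) (lam x2) 0 (bit x1) (bit x2) xpredT) => i.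
  by rewrite -coord big_cons big_seq1; ring.
apply: (@three_signs_not_powers (lam x1) (lam x2) (lam x3) (bit x1) (bit x2) (bit x3)) => i.
by rewrite -coord !big_cons big_nil; ring.
Qed.

Lemma even_target_cone_facets s : cube_face s -> #|s| = 5%N ->
  ~~ odd #|facets_in (fun r => `[< in_cone sign_vector target r >]) s|.
Proof.
move=> [a [k /subsetP sa]] s5; apply: (@even_cone_facets _ _ _ _ _ _ (off_axis_sum a k)).
- by rewrite dimvf dim_matrix mul1r.
- exact: generic_target_vector.
- by move=> x /sa/off_axis_sum_gt0.
Qed.

Lemma target_cone_facet sigma :
  in_cone sign_vector target (cross_facet pole sigma 4) <-> forall i, (i < 4)%N -> sigma i = false.
Proof.
rewrite in_cone_cross_facetP; last exact: distinct_poles_pole.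
have coordE (l : nat -> rat) (j : 'I_4) :
    (\sum_(i < 4) l i *: sign_vector (pole i (sigma i))) 0 j =
    \sum_(i < 4) (-1) ^+ (j < i)%N * (l i * (-1) ^+ sigma i).
  rewrite summxE; apply: eq_bigr => i _.
  by rewrite !mxE !ffunE /= ltn_ord /= signr_addb mulrCA.
split=> [[l l_ge0 /rowP eq_target]|sigma0].
  have eq_coord (j : 'I_4) : \sum_(i < 4) (-1) ^+ (j < i)%N * (l i * (-1) ^+ sigma i) = 2 ^+ j.
    by rewrite -(coordE l) eq_target mxE.
  have signed_gt0 i : (i < 4)%N -> 0 < l i * (-1) ^+ sigma i.
    have := (eq_coord ord0, eq_coord (inord 1), eq_coord (inord 2), eq_coord (inord 3)).
    rewrite !big_ord_recr !big_ord0 /= !inordK //= => -[[[y0 y1] y2] y3].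
    by move: i => [|[|[|[|]]]] //= _; lra.
  move=> i i4; apply/negP => sigma_i; have := signed_gt0 i i4.
  by rewrite sigma_i expr1 mulrN1 oppr_gt0 ltNge l_ge0.
exists (nth 0 [:: 9 / 2; 1 / 2; 1; 2]); first by do 4?case=> //.
apply/rowP => j; rewrite coordE mxE !big_ord_recr big_ord0 /= !sigma0 //.
by case: j => [[|[|[|[|]]]] ?] //=; lra.
Qed.

Lemma cube_homology3_neq0 (R : realType) :
  exists h : reduced_homology (cech (hypercube n) (3 : R)) 3, h != 0.
Proof.
have n0 : (0 < n)%N by apply: leq_trans n4.
apply: (@cube_homology_neq0 R n n0 4 (fun r => `[< in_cone sign_vector target r >])
          (cross_cycle pole 4)).
- exact: bdry_cross_cycle.
- move=> s /cross_cycle_supp[sigma ->]; split; first exact: cross_facet_face.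
  exact: card_cross_facet distinct_poles_pole.
- exact: even_target_cone_facets.
rewrite (@mod2_pairing_unique _ _ _ (cross_facet pole xpred0 4)).
- by rewrite cross_cycle_facet //; exact: distinct_poles_pole.
- by apply/asboolP/target_cone_facet.
move=> _ /cross_cycle_supp[sigma ->] /asboolP/target_cone_facet sigma0.
exact: eq_cross_facet.
Qed.

End DegreeThree.

Theorem theorem5p13 (R : realType) (n : nat) (hn : (4 <= n)%N) (i : int) :
  (exists h : reduced_homology (cech (hypercube n) (3 : R)) i, h != 0) <->
  (i = 3 \/ i = 4).
Proof.
have n0 : (0 < n)%N by apply: leq_trans hn.
split=> [hi|[->|->]]; [|exact: cube_homology3_neq0 | exact: cube_homology4_neq0 (ltnW hn) R].
have [i_ge|i_lt] := leP (-1) i; last by case: (homology_eq0_lt i_lt hi).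
have [m iE] : exists m : nat, i = m%:Z - 1 by exists (absz (i + 1)); lia.
have [m_vanish|] := boolP ((m <= 3) || (6 <= m))%N; last by lia.
by case: (@cube_homology_eq0 R n n0 m m_vanish); rewrite -iE.
Qed.
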